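(* Let $\{R_i\}_{i\in I}$ be an inverse system of discrete rings such that each $R_i$ is $\pi$-regular, and let $R=\varprojlim\{R_i\}_{i\in I}$ (as a topological ring). Denote by $J_i$ the kernel of the standard map $R\to R_i$ and let $R_0$ be a T-semi-invariant subring of $R$. Then: (i) $R_0$ is quasi-$\pi$-regular and $R_0=\varprojlim\{R_0/(J_i\cap R_0)\}_{i\in I}$. (ii) If $R$ does not contain an infinite set of orthogonal idempotents, then $R_0$ is semiperfect and there is $n\in\mathbb{N}$ such that $\mathrm{Jac}(R_0)^n\subseteq\mathrm{Jac}(R)$. (iii) For all $i\in I$, $R_0/(J_i\cap R_0)$ is $\pi$-regular. If moreover $R_i$ is semiprimary (resp. right perfect, semiperfect), then so is $R_0/(J_i\cap R_0)$. In particular, if $R$ is pro-semiprimary (resp. pro-right-perfect, pro-($\pi$-regular and semiperfect)), then so is $R_0$ (with respect to the induced topology).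
   Context: All rings are unital, ring homomorphisms preserve the unity, and subrings share the unity of the ambient ring. Inverse systems are indexed by directed sets $I$, with ring homomorphisms $f_{ij}:R_j\to R_i$ for $i\le j$ (not assumed onto) satisfying $f_{ii}=\mathrm{id}$, $f_{ij}f_{jk}=f_{ik}$; the inverse limit is the ring of compatible tuples in $\prod_i R_i$ with the topology induced from the product topology. A topological ring is linearly topologized (LT) if it has a basis of neighborhoods of $0$ consisting of two-sided ideals. Subrings carry the induced topology. A subring $R_0$ of a Hausdorff LT ring $R$ is T-semi-invariant if there is a Hausdorff LT ring $S$ containing $R$ as a topological subring and a set $\Sigma$ of continuous ring endomorphisms of $S$ such that $R_0=\{r\in R:\sigma(r)=r\ \text{for all }\sigma\in\Sigma\}$. An element $a$ of a Hausdorff LT ring $R$ is quasi-$\pi$-regular if there is an idempotent $e\in R$ such that, with $f:=1-e$: $a=eae+faf$; $eae$ is invertible in $eRe$; and $(faf)^n\to 0$ as $n\to\infty$. $R$ is quasi-$\pi$-regular if all its elements are. A ring is $\pi$-regular if for every element $a$ the chain $aR\supseteq a^2R\supseteq\cdots$ stabilizes. A ring is semilocal if $R/\mathrm{Jac}(R)$ is semisimple artinian; semiperfect if semilocal and idempotents lift modulo $\mathrm{Jac}(R)$; semiprimary if semilocal with $\mathrm{Jac}(R)$ nilpotent; right perfect if semilocal and for every sequence $x_1,x_2,\dots\in\mathrm{Jac}(R)$ the sequence $x_1,x_2x_1,x_3x_2x_1,\dots$ eventually vanishes. For a ring property $\mathcal{P}$, a topological ring is pro-$\mathcal{P}$ if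 it is isomorphic, as a topological ring, to the inverse limit of an inverse system of discrete rings satisfying $\mathcal{P}$. *)

(* Defs.v *)
From HB Require Import structures.
From mathcomp Require Import all_boot all_order all_algebra.
From mathcomp Require Import generic_quotient ring_quotient.
From mathcomp Require Import all_classical all_reals all_analysis.

Set Implicit Arguments.
Unset Strict Implicit.
Unset Printing Implicit Defensive.

Import Order.TTheory GRing.Theory Quotient.

Local Open Scope classical_set_scope.
Local Open Scope ring_scope.

(* Rings are [pzRingType]s: unital, not assumed commutative, and possibly
   zero. *)

HB.mixin Record TopologicalZmodule_isTopologicalRing R
    & TopologicalZmodule R & GRing.PzRing R := {
  mul_continuous : continuous (fun x : R * R => x.1 * x.2) ;
}.

#[short(type="topRingType")]
HB.structure Definition TopologicalRing :=
  {R of TopologicalZmodule R & GRing.PzRing R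
        & TopologicalZmodule_isTopologicalRing R}.

Section DiscreteRing.
Variable R : pzRingType.
Local Notation D := (discrete_topology R).

HB.instance Definition _ := GRing.PzRing.copy D R.

Lemma discrete_cvg2 (f : D * D -> D) : continuous f.
Proof.
move=> x U /= /nbhs_singleton Ux; exists ([set x.1], [set x.2]).
  by split; apply: discrete_set1.
by move=> [a b] /= [-> ->]; rewrite -surjective_pairing.
Qed.

HB.instance Definition _ :=
  PreTopologicalNmodule_isTopologicalZmodule.Build D (@discrete_cvg2 _).
HB.instance Definition _ :=
  TopologicalZmodule_isTopologicalRing.Build D (@discrete_cvg2 _).
End DiscreteRing.

Section ProductRing.
Variables (I : choiceType) (X : I -> topRingType).
Local Notation P := (prod_topology X).

Definition prod_zero : P := fun i => 0.
Definition prod_opp (x : P) : P := fun i => - x i.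
Definition prod_add (x y : P) : P := fun i => x i + y i.
Definition prod_one : P := fun i => 1.
Definition prod_mul (x y : P) : P := fun i => x i * y i.

Fact prod_addA : associative prod_add.
Proof. by move=> x y z; apply: functional_extensionality_dep => i; apply: addrA. Qed.
Fact prod_addC : commutative prod_add.
Proof. by move=> x y; apply: functional_extensionality_dep => i; apply: addrC. Qed.
Fact prod_add0 : left_id prod_zero prod_add.
Proof. by move=> x; apply: functional_extensionality_dep => i; apply: add0r. Qed.
Fact prod_addN : left_inverse prod_zero prod_opp prod_add.
Proof. by move=> x; apply: functional_extensionality_dep => i; apply: addNr. Qed.
HB.instance Definition _ :=
  GRing.isZmodule.Build P prod_addA prod_addC prod_add0 prod_addN.

Fact prod_mulA : associative prod_mul.
Proof. by move=> x y z; apply: functional_extensionality_dep => i; apply: mulrA. Qed.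
Fact prod_mul1l : left_id prod_one prod_mul.
Proof. by move=> x; apply: functional_extensionality_dep => i; apply: mul1r. Qed.
Fact prod_mul1r : right_id prod_one prod_mul.
Proof. by move=> x; apply: functional_extensionality_dep => i; apply: mulr1. Qed.
Fact prod_mulDl : left_distributive prod_mul prod_add.
Proof. by move=> x y z; apply: functional_extensionality_dep => i; apply: mulrDl. Qed.
Fact prod_mulDr : right_distributive prod_mul prod_add.
Proof. by move=> x y z; apply: functional_extensionality_dep => i; apply: mulrDr. Qed.
HB.instance Definition _ := GRing.Zmodule_isPzRing.Build P
  prod_mulA prod_mul1l prod_mul1r prod_mulDl prod_mulDr.

Lemma prod_continuous (T : topologicalType) (f : T -> P) :
  (forall i, continuous (fun t => f t i)) -> continuous f.
Proof.
move=> cf t; apply/cvg_sup => i U [_ [[B oB <-] Bt] BU].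
by apply: filterS BU _; apply: cf; apply: open_nbhs_nbhs.
Qed.

Lemma prod_op2_continuous (op : forall i, X i -> X i -> X i) :
  (forall i, continuous (fun z : X i * X i => op i z.1 z.2)) ->
  continuous (fun z : P * P => (fun i => op i (z.1 i) (z.2 i)) : P).
Proof.
move=> cop; apply: prod_continuous => i z.
apply: (@continuous_comp _ _ _ (fun z : P * P => (z.1 i, z.2 i))
  (fun z : X i * X i => op i z.1 z.2)); last exact: cop.
apply: cvg_pair; apply: (@continuous_comp _ _ _ _ (fun x : P => x i)).
- exact: cvg_fst.
- exact: (@proj_continuous I X i).
- exact: cvg_snd.
- exact: (@proj_continuous I X i).
Qed.

Fact prod_sub_continuous : continuous (fun z : P * P => z.1 - z.2).
Proof.
exact: (prod_op2_continuous (op := fun i x y => x - y)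
  (fun i => @sub_continuous (X i))).
Qed.
HB.instance Definition _ :=
  PreTopologicalNmodule_isTopologicalZmodule.Build P prod_sub_continuous.

Fact prod_mul_continuous : continuous (fun z : P * P => z.1 * z.2).
Proof.
exact: (prod_op2_continuous (op := fun i x y => x * y)
  (fun i => @mul_continuous (X i))).
Qed.
HB.instance Definition _ :=
  TopologicalZmodule_isTopologicalRing.Build P prod_mul_continuous.
End ProductRing.

Definition subring_type (R : pzRingType) (S : subringClosed R) : Type :=
  {x : R | x \in S}.

Section SubRing.
Variables (R : pzRingType) (S : subringClosed R).
HB.instance Definition _ := SubChoice.copy (subring_type S) {x : R | x \in S}.
HB.instance Definition _ :=
  GRing.SubChoice_isSubPzRing.Build _ _ (subring_type S) (subringClosedP _).
End SubRing.

Section SubTopRing.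
Variables (R : topRingType) (S : subringClosed R).
Local Notation T := (subring_type S).

HB.instance Definition _ :=
  Topological.copy T (initial_topology (val : T -> R)).

Lemma val_continuous : continuous (val : T -> R).
Proof. exact: initial_continuous. Qed.

Lemma continuous_into_subring (U : topologicalType) (f : U -> T) :
  continuous (val \o f : U -> R) -> continuous f.
Proof.
move=> cf u V [_ [[B oB <-] Bt] BV].
by apply: filterS BV _; apply: cf; apply: open_nbhs_nbhs.
Qed.

Lemma sub_op2_continuous (op : R -> R -> R) (opS : T -> T -> T) :
  (forall x y, val (opS x y) = op (val x) (val y)) ->
  continuous (fun z : R * R => op z.1 z.2) ->
  continuous (fun z : T * T => opS z.1 z.2).
Proof.
move=> opE cop; apply: continuous_into_subring => z.
have -> : val \o (fun z : T * T => opS z.1 z.2) =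
  (fun z : R * R => op z.1 z.2) \o (fun z : T * T => (val z.1, val z.2)).
  by apply/funext => t /=; rewrite opE.
apply: continuous_comp; last exact: cop.
apply: cvg_pair; apply: continuous_comp.
- exact: cvg_fst.
- exact: val_continuous.
- exact: cvg_snd.
- exact: val_continuous.
Qed.

Fact subring_sub_continuous : continuous (fun z : T * T => z.1 - z.2).
Proof.
apply: (@sub_op2_continuous (fun x y => x - y) (fun x y => x - y)).
  exact: rmorphB.
exact: sub_continuous.
Qed.
HB.instance Definition _ :=
  PreTopologicalNmodule_isTopologicalZmodule.Build T subring_sub_continuous.

Fact subring_mul_continuous : continuous (fun z : T * T => z.1 * z.2).
Proof.
apply: (@sub_op2_continuous (fun x y => x * y) (fun x y => x * y)).
  exact: rmorphM.
exact: mul_continuous.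
Qed.
HB.instance Definition _ :=
  TopologicalZmodule_isTopologicalRing.Build T subring_mul_continuous.
End SubTopRing.

HB.mixin Record isTwoSided (R : pzRingType) (S : R -> bool) := {
  ideal_mulMl : forall a x, x \in (S : {pred R}) -> a * x \in (S : {pred R}) ;
  ideal_mulMr : forall a x, x \in (S : {pred R}) -> x * a \in (S : {pred R})
}.

#[short(type="ideal")]
HB.structure Definition Ideal (R : pzRingType) :=
  {S of GRing.ZmodClosed R S & isTwoSided R S}.

(* The library makes the quotient group [{quot I}] a ring only over commutative
   rings and proper ideals; the alias [ring_quot I] carries the ring structure
   for a two-sided ideal [I] of any ring. *)
Definition ring_quot (R : pzRingType) (I : ideal R) : Type := {quot I}.

Section QuotientRing.
Local Open Scope quotient_scope.
Variables (R : pzRingType) (I : ideal R).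
Local Notation Q := (ring_quot I).

HB.instance Definition _ : EqQuotient R (equiv I) Q := EqQuotient.on Q.
HB.instance Definition _ := Choice.on Q.
HB.instance Definition _ := ZmodQuotient.on Q.

Definition quot_one : Q := lift_cst Q 1.
Definition quot_mul := lift_op2 Q *%R.
Canonical pi_quot_one_morph := PiConst quot_one.

Lemma pi_quot_mul : {morph \pi : x y / x * y >-> quot_mul x y}.
Proof.
move=> x y; unlock quot_mul; apply/eqP; rewrite piE equivE.
rewrite -[_ * _](addrNK (x * repr (\pi_Q y))) -mulrBr.
rewrite -addrA -mulrBl rpredD //.
  by rewrite ideal_mulMl // idealrDE opprK reprK.
by rewrite ideal_mulMr // idealrDE opprK reprK.
Qed.
Canonical pi_quot_mul_morph := PiMorph2 pi_quot_mul.

Fact quot_mulA : associative quot_mul.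
Proof. by move=> x y z; rewrite -[x]reprK -[y]reprK -[z]reprK !piE mulrA. Qed.
Fact quot_mul1l : left_id quot_one quot_mul.
Proof. by move=> x; rewrite -[x]reprK !piE mul1r. Qed.
Fact quot_mul1r : right_id quot_one quot_mul.
Proof. by move=> x; rewrite -[x]reprK !piE mulr1. Qed.
Fact quot_mulDl : left_distributive quot_mul +%R.
Proof.
move=> x y z; rewrite -[x]reprK -[y]reprK -[z]reprK.
by rewrite !piE mulrDl.
Qed.
Fact quot_mulDr : right_distributive quot_mul +%R.
Proof.
move=> x y z; rewrite -[x]reprK -[y]reprK -[z]reprK.
by rewrite !piE mulrDr.
Qed.
HB.instance Definition _ := GRing.Zmodule_isPzRing.Build Q
  quot_mulA quot_mul1l quot_mul1r quot_mulDl quot_mulDr.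

Definition quot_pi (x : R) : Q := \pi_Q x.

Fact quot_pi_is_zmod_morphism : zmod_morphism quot_pi.
Proof. by move=> x y; rewrite /quot_pi !piE. Qed.
HB.instance Definition _ :=
  GRing.isZmodMorphism.Build R Q quot_pi quot_pi_is_zmod_morphism.
Fact quot_pi_is_monoid_morphism : monoid_morphism quot_pi.
Proof. by split=> [|x y]; rewrite /quot_pi !piE. Qed.
HB.instance Definition _ :=
  GRing.isMonoidMorphism.Build R Q quot_pi quot_pi_is_monoid_morphism.

Lemma quot_piP x y : (quot_pi x == quot_pi y) = (x - y \in I).
Proof. by rewrite /quot_pi -idealrBE. Qed.
End QuotientRing.

Section QuotientMap.
Variables (R : pzRingType) (I J : ideal R) (IJ : {subset I <= J}).

Definition quot_map (x : ring_quot I) : ring_quot J := quot_pi J (repr x).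

Lemma quot_mapE x : quot_map (quot_pi I x) = quot_pi J x.
Proof.
apply/eqP; rewrite /quot_map quot_piP; apply: IJ.
by rewrite -quot_piP {1}/quot_pi reprK.
Qed.

Lemma quot_piW (x : ring_quot I) : quot_pi I (repr x) = x.
Proof. exact: reprK. Qed.

Fact quot_map_is_zmod_morphism : zmod_morphism quot_map.
Proof.
by move=> x y; rewrite -[x]quot_piW -[y]quot_piW -rmorphB !quot_mapE rmorphB.
Qed.
Fact quot_map_is_monoid_morphism : monoid_morphism quot_map.
Proof.
split=> [|x y]; first by rewrite -(rmorph1 (quot_pi I)) quot_mapE rmorph1.
by rewrite -[x]quot_piW -[y]quot_piW -rmorphM !quot_mapE rmorphM.
Qed.

Definition quot_rmorph : {rmorphism ring_quot I -> ring_quot J} :=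
  HB.pack quot_map
    (GRing.isZmodMorphism.Build _ _ quot_map quot_map_is_zmod_morphism)
    (GRing.isMonoidMorphism.Build _ _ quot_map quot_map_is_monoid_morphism).
End QuotientMap.

Section Kernel.
Variables (R S : pzRingType) (f : {rmorphism R -> S}).

Definition rker : {pred R} := [pred x | f x == 0].

Fact rker_zmod_closed : zmod_closed rker.
Proof.
split=> [|x y]; rewrite !inE ?rmorph0 // => /eqP fx /eqP fy.
by rewrite rmorphB fx fy subr0.
Qed.
Fact rker_mulMl a x : x \in rker -> a * x \in rker.
Proof. by rewrite !inE rmorphM => /eqP ->; rewrite mulr0. Qed.
Fact rker_mulMr a x : x \in rker -> x * a \in rker.
Proof. by rewrite !inE rmorphM => /eqP ->; rewrite mul0r. Qed.
HB.instance Definition _ := GRing.isZmodClosed.Build R rker rker_zmod_closed.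
HB.instance Definition _ := isTwoSided.Build R rker rker_mulMl rker_mulMr.
End Kernel.

(* [J] intersected with [R0], as an ideal of the ring [R0]. *)
Section Restriction.
Variables (R : pzRingType) (R0 : subringClosed R) (J : ideal R).
Local Notation T := (subring_type R0).

Definition ideal_cap : {pred T} := [pred x : T | val x \in J].

Fact ideal_cap_zmod_closed : zmod_closed ideal_cap.
Proof.
by split=> [|x y]; rewrite !inE ?rmorph0 ?rpred0 // rmorphB; apply: rpredB.
Qed.
Fact ideal_cap_mulMl a x : x \in ideal_cap -> a * x \in ideal_cap.
Proof. by rewrite !inE rmorphM; apply: ideal_mulMl. Qed.
Fact ideal_cap_mulMr a x : x \in ideal_cap -> x * a \in ideal_cap.
Proof. by rewrite !inE rmorphM; apply: ideal_mulMr. Qed.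
HB.instance Definition _ :=
  GRing.isZmodClosed.Build T ideal_cap ideal_cap_zmod_closed.
HB.instance Definition _ :=
  isTwoSided.Build T ideal_cap ideal_cap_mulMl ideal_cap_mulMr.
End Restriction.

Arguments ideal_cap {R} R0 J.

Definition directed d (I : preorderType d) : Prop :=
  inhabited I /\
  forall i j : I, exists k : I, (i <= k)%O /\ (j <= k)%O.

Record inverse_system d (I : preorderType d) := InverseSystem {
  sys_obj :> I -> pzRingType ;
  sys_map : forall i j : I, (i <= j)%O -> {rmorphism sys_obj j -> sys_obj i} ;
  sys_directed : directed I ;
  sys_map_id : forall i (ii : (i <= i)%O) x, sys_map ii x = x ;
  sys_map_comp : forall i j k (ij : (i <= j)%O) (jk : (j <= k)%O)
      (ik : (i <= k)%O) x, sys_map ij (sys_map jk x) = sys_map ik x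
}.

Section InverseLimit.
Variables (d : Order.disp_t) (I : preorderType d) (X : inverse_system I).

Definition sys_prod : topRingType :=
  prod_topology (fun i => discrete_topology (X i)).

Definition compatible : {pred sys_prod} := fun x =>
  `[< forall i j (ij : (i <= j)%O), sys_map X ij (x j) = x i >].

Fact compatible_subring_closed : subring_closed compatible.
Proof.
split=> [|x y|x y].
- by apply/asboolP => i j ij; apply: rmorph1.
- move=> /asboolP cx /asboolP cy; apply/asboolP => i j ij.
  by rewrite [LHS]rmorphB cx cy.
- move=> /asboolP cx /asboolP cy; apply/asboolP => i j ij.
  by rewrite [LHS]rmorphM cx cy.
Qed.
HB.instance Definition _ :=
  GRing.isSubringClosed.Build sys_prod compatible compatible_subring_closed.

Definition invlim : topRingType := subring_type compatible.

Definition invlim_proj (i : I) (x : invlim) : X i :=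
  (val (x : subring_type compatible) : sys_prod) i.

Fact invlim_proj_is_zmod_morphism i : zmod_morphism (invlim_proj i).
Proof. by []. Qed.
HB.instance Definition _ i := GRing.isZmodMorphism.Build invlim (X i)
  (invlim_proj i) (invlim_proj_is_zmod_morphism i).
Fact invlim_proj_is_monoid_morphism i : monoid_morphism (invlim_proj i).
Proof. by []. Qed.
HB.instance Definition _ i := GRing.isMonoidMorphism.Build invlim (X i)
  (invlim_proj i) (invlim_proj_is_monoid_morphism i).

Lemma invlim_compat i j (ij : (i <= j)%O) x :
  sys_map X ij (invlim_proj j x) = invlim_proj i x.
Proof. by case: x => x /= xc; have /asboolP := xc; apply. Qed.
End InverseLimit.

Arguments compatible {d I} X.

Definition top_ring_iso (R S : topRingType) (f : {rmorphism R -> S}) : Prop :=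
  continuous f /\
  exists g : S -> R, [/\ cancel f g, cancel g f & continuous g].

(* The rings of an [inverse_system] are discrete by construction of
   [invlim]. *)
Definition pro (P : pzRingType -> Prop) (R : topRingType) : Prop :=
  exists (d : Order.disp_t) (I : preorderType d) (X : inverse_system I)
         (f : {rmorphism R -> invlim X}),
    top_ring_iso f /\ forall i, P (X i).

(* The inverse system of the quotients of [T] by a decreasing family [K] of
   ideals, and the canonical map from [T] to its limit. *)
Section QuotientSystem.
Variables (d : Order.disp_t) (I : preorderType d) (Idir : directed I).
Variables (T : pzRingType) (K : I -> ideal T).
Hypothesis Kdecr : forall i j, (i <= j)%O -> {subset K j <= K i}.

Fact quot_system_id i (ii : (i <= i)%O) (x : ring_quot (K i)) :
  quot_rmorph (Kdecr ii) x = x.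
Proof. by rewrite -[x]quot_piW; apply: quot_mapE; apply: Kdecr. Qed.
Fact quot_system_comp i j k (ij : (i <= j)%O) (jk : (j <= k)%O)
    (ik : (i <= k)%O) (x : ring_quot (K k)) :
  quot_rmorph (Kdecr ij) (quot_rmorph (Kdecr jk) x) = quot_rmorph (Kdecr ik) x.
Proof.
by rewrite -[x]quot_piW /= !quot_mapE //; apply: Kdecr.
Qed.

Definition quot_system : inverse_system I :=
  @InverseSystem d I (fun i => ring_quot (K i))
    (fun i j ij => quot_rmorph (Kdecr ij)) Idir quot_system_id quot_system_comp.

Definition quot_tuple (x : T) : sys_prod quot_system := fun i => quot_pi (K i) x.

Fact quot_tuple_compatible x : quot_tuple x \in compatible quot_system.
Proof.
by apply/asboolP => i j ij; apply: quot_mapE; apply: Kdecr.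
Qed.

Definition quot_can (x : T) : invlim quot_system :=
  exist _ (quot_tuple x) (quot_tuple_compatible x).

Fact quot_can_is_zmod_morphism : zmod_morphism quot_can.
Proof.
move=> x y; apply: val_inj; apply: functional_extensionality_dep => i.
exact: (rmorphB (quot_pi (K i))).
Qed.
HB.instance Definition _ :=
  GRing.isZmodMorphism.Build T (invlim quot_system) quot_can
    quot_can_is_zmod_morphism.
Fact quot_can_is_monoid_morphism : monoid_morphism quot_can.
Proof.
split=> [|x y]; apply: val_inj; apply: functional_extensionality_dep => i.
  exact: (rmorph1 (quot_pi (K i))).
exact: (rmorphM (quot_pi (K i))).
Qed.
HB.instance Definition _ :=
  GRing.isMonoidMorphism.Build T (invlim quot_system) quot_can
    quot_can_is_monoid_morphism.
End QuotientSystem.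

(* [J_ phi i] is the kernel of the standard map [R -> X i], where [R] is
   identified with the limit of [X] through [phi]. *)
Section StandardKernels.
Variables (d : Order.disp_t) (I : preorderType d) (X : inverse_system I).
Variables (R : topRingType) (phi : {rmorphism R -> invlim X}).
Variable R0 : subringClosed R.

Definition std_map (i : I) : {rmorphism R -> X i} :=
  @invlim_proj d I X i \o phi.

Definition J_ (i : I) : ideal R := rker (std_map i).

Definition J0_ (i : I) : ideal (subring_type R0) := ideal_cap R0 (J_ i).

Lemma J0_decr i j : (i <= j)%O -> {subset J0_ j <= J0_ i}.
Proof.
move=> ij x; rewrite !inE => /eqP xj; apply/eqP.
by rewrite /= -(invlim_compat ij) [invlim_proj _ _]xj rmorph0.
Qed.

Definition J0_system : inverse_system I :=
  quot_system (sys_directed X) J0_decr.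

Definition J0_can : {rmorphism subring_type R0 -> invlim J0_system} :=
  quot_can (sys_directed X) J0_decr.
End StandardKernels.

Definition linearly_topologized (R : topRingType) : Prop :=
  forall U : set R, nbhs 0 U ->
    exists J : ideal R, nbhs (0 : R) [set` J] /\ [set` J] `<=` U.

Definition topological_embedding (R S : topologicalType) (f : R -> S) : Prop :=
  injective f /\
  forall U : set R, open U <-> exists2 V : set S, open V & U = f @^-1` V.

Definition T_semi_invariant (R : topRingType) (R0 : subringClosed R) : Prop :=
  exists (S : topRingType) (iota : {rmorphism R -> S})
         (Sigma : set {rmorphism S -> S}),
    [/\ hausdorff_space S /\ linearly_topologized S,
        topological_embedding iota,
        forall sigma : {rmorphism S -> S}, Sigma sigma -> continuous sigma
      & forall r : R, r \in R0 <->
          forall sigma : {rmorphism S -> S}, Sigma sigma ->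
            sigma (iota r) = iota r].

(* The two equations on [b] say that [e * a * e] is invertible in the ring
   [eRe], whose unity is [e]. *)
Definition quasi_pi_regular_elt (R : topRingType) (a : R) : Prop :=
  exists e : R, let f := 1 - e in
    [/\ e * e = e,
        a = e * a * e + f * a * f,
        exists b : R, [/\ b = e * b * e, (e * a * e) * b = e
                        & b * (e * a * e) = e]
      & (fun n : nat => (f * a * f) ^+ n) @ \oo --> (0 : R)].

Definition quasi_pi_regular (R : topRingType) : Prop :=
  forall a : R, quasi_pi_regular_elt a.

Definition principal_right_ideal (R : pzRingType) (a : R) : set R :=
  range (fun r : R => a * r).

Definition pi_regular (R : pzRingType) : Prop :=
  forall a : R, exists n : nat, forall m : nat, (n <= m)%N ->
    principal_right_ideal (a ^+ m.+1) = principal_right_ideal (a ^+ n.+1).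

Definition right_ideal (R : pzRingType) (K : set R) : Prop :=
  [/\ K 0, forall x y, K x -> K y -> K (x - y)
    & forall x a, K x -> K (x * a)].

Definition maximal_right_ideal (R : pzRingType) (M : set R) : Prop :=
  [/\ right_ideal M, M <> setT
    & forall K : set R, right_ideal K -> M `<=` K -> K = M \/ K = setT].

Definition Jac (R : pzRingType) : {pred R} := fun x =>
  `[< forall M : set R, maximal_right_ideal M -> M x >].

Section JacIdeal.
Variable R : pzRingType.

Fact right_ideal_setT (K : set R) : right_ideal K -> K 1 -> K = setT.
Proof.
move=> [_ _ KM] K1; apply/seteqP; split=> // x _.
by rewrite -[x]mul1r; apply: KM.
Qed.

Fact right_idealD (K : set R) x y : right_ideal K -> K x -> K y -> K (x + y).
Proof.
move=> [K0 KB _] Kx Ky; rewrite -[y]opprK; apply: (KB) => //.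
by rewrite -[- y]sub0r; apply: KB.
Qed.

Fact Jac_zmod_closed : zmod_closed (@Jac R).
Proof.
split=> [|x y /asboolP Jx /asboolP Jy]; apply/asboolP => M Mmax.
  by case: Mmax => -[].
by case: (Mmax) => -[_ MB _] _ _; apply: MB; [apply: Jx|apply: Jy].
Qed.

Fact Jac_mulMr a x : x \in @Jac R -> x * a \in @Jac R.
Proof.
move=> /asboolP Jx; apply/asboolP => M Mmax.
by case: (Mmax) => -[_ _ MM] _ _; apply: MM; apply: Jx.
Qed.

Fact Jac_mulMl a x : x \in @Jac R -> a * x \in @Jac R.
Proof.
move=> /asboolP Jx; apply/asboolP => M Mmax.
have [[M0 MB MM] MT Mm] := Mmax.
have Mrid : right_ideal M by [].
have [Ma|Ma] := pselect (M a); first exact: MM.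
suff /Jx : maximal_right_ideal [set y | M (a * y)] by [].
split; [split|..] => /=.
- by rewrite mulr0.
- by move=> y z My Mz; rewrite mulrBr; apply: MB.
- by move=> y b My; rewrite mulrA; apply: MM.
- by move=> /seteqP[_ /(_ 1 I)] /=; rewrite mulr1.
move=> K Krid MK; have [K0 KB KM] := Krid.
have [KsubM|] := pselect (forall k, K k -> M (a * k)).
  by left; apply/seteqP; split.
move=> /existsNP[k /not_implyP[Kk Mak]]; right.
pose N : set R := [set y | exists m r, M m /\ y = m + a * k * r].
have Nrid : right_ideal N.
  split.
  - by exists 0, 0; rewrite mulr0 addr0.
  - move=> _ _ [m [r [Mm' ->]]] [m' [r' [Mm'' ->]]]; exists (m - m'), (r - r').
    by split; [apply: MB|rewrite mulrBr opprD addrACA].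
  - move=> _ b [m [r [Mm' ->]]]; exists (m * b), (r * b).
    by split; [apply: MM|rewrite mulrDl !mulrA].
have [|NM|NT] := Mm N Nrid.
- by move=> m Mm'; exists m, 0; rewrite mulr0 addr0.
- exfalso; apply: Mak; rewrite -NM; exists 0, 1.
  by rewrite mulr1 add0r.
have [m [r [Mm' aE]]] : N a by rewrite NT.
apply: right_ideal_setT => //.
have -> : 1 = (1 - k * r) + k * r by rewrite subrK.
apply: right_idealD => //; last exact: KM.
apply: MK => /=; rewrite mulrBr mulr1 mulrA.
by rewrite {1}aE addrK.
Qed.

HB.instance Definition _ := GRing.isZmodClosed.Build R (@Jac R) Jac_zmod_closed.
HB.instance Definition _ := isTwoSided.Build R (@Jac R) Jac_mulMl Jac_mulMr.
End JacIdeal.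

Arguments Jac : clear implicits.

Definition right_artinian (R : pzRingType) : Prop :=
  forall K : nat -> set R,
    (forall n, right_ideal (K n)) -> (forall n, K n.+1 `<=` K n) ->
    exists n, forall m, (n <= m)%N -> K m = K n.

(* "Semisimple" is taken in the sense of Jacobson (zero radical); together with
   the artinian condition this is semisimplicity of the right regular module. *)
Definition semisimple_artinian (R : pzRingType) : Prop :=
  right_artinian R /\ (forall x : R, x \in Jac R -> x = 0).

Definition semilocal (R : pzRingType) : Prop :=
  semisimple_artinian (ring_quot (Jac R : ideal R)).

Definition semiperfect (R : pzRingType) : Prop :=
  semilocal R /\
  forall x : R, x * x - x \in Jac R ->
    exists e : R, e * e = e /\ e - x \in Jac R.

(* Additive subgroup generated by the products of [n] elements of [J]. *)
Fixpoint ideal_pow (R : pzRingType) (J : ideal R) (n : nat) : set R :=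
  if n is m.+1 then
    [set x | exists (k : nat) (a b : 'I_k -> R),
       [/\ forall i, a i \in J, forall i, ideal_pow J m (b i)
         & x = \sum_i a i * b i]]
  else setT.

Definition semiprimary (R : pzRingType) : Prop :=
  semilocal R /\ exists n : nat, ideal_pow (Jac R : ideal R) n = [set 0].

(* [left_prod x n] is [x n * ... * x 1 * x 0]. *)
Fixpoint left_prod (R : pzRingType) (x : nat -> R) (n : nat) : R :=
  if n is m.+1 then x n * left_prod x m else x 0%N.

Definition right_perfect (R : pzRingType) : Prop :=
  semilocal R /\
  forall x : nat -> R, (forall n, x n \in Jac R) ->
    exists N : nat, forall n, (N <= n)%N -> left_prod x n = 0.

Definition pi_regular_semiperfect (R : pzRingType) : Prop :=
  pi_regular R /\ semiperfect R.

Definition orthogonal_idempotents (R : pzRingType) (E : set R) : Prop :=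
  (forall e, E e -> e * e = e) /\
  (forall e f, E e -> E f -> e <> f -> e * f = 0).

(* Main.v *)
(** In a pi-regular ring every [a] has a Fitting decomposition: an idempotent [e]
    commuting with [a] such that [ea] is invertible in [eRe] and [(1 - e)a] is
    nilpotent (Dischinger). The pair made of [e] and the inverse of [ea] is
    unique, even when [(1 - e)a] is only topologically nilpotent in a Hausdorff
    linearly topologized ring. Uniqueness glues the decompositions in the [R_i]
    into one in the limit [R], and shows that continuous endomorphisms fixing [a]
    fix it; hence it lies in [R_0] as soon as [a] does.

    A decomposition of every element makes the ring strongly clean; together with
    the maximum condition on idempotents, every right ideal containing the
    Jacobson radical [J] is of the form [eR + J], which yields semiperfectness and
    both chain conditions modulo [J]. The maximum condition passes to subrings and
    holds in semilocal rings. Levitzki's theorem modulo [J] then compares the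
    radical of a subring with that of the ambient ring. *)
Require Import Defs.
From HB Require Import structures.
From mathcomp Require Import all_boot all_order all_algebra.
From mathcomp Require Import generic_quotient ring_quotient.
From mathcomp Require Import all_classical all_reals all_analysis.

Set Implicit Arguments.
Unset Strict Implicit.
Unset Printing Implicit Defensive.

Import Order.TTheory GRing.Theory Quotient.

Local Open Scope classical_set_scope.
Local Open Scope ring_scope.

(** * The Jacobson radical *)

Section Jacobson.
Variable R : pzRingType.
Implicit Types (x y z a e f : R) (K M : set R).

Lemma maximal_right_ideal_above K : right_ideal K -> ~ K 1 ->
  exists2 M, maximal_right_ideal M & K `<=` M.
Proof.
move=> [K0 KB KM] K1.
(* Adjoining [K] inside [P] lets the empty chain, whose union is empty, satisfy [P] as well. *)
pose P A := right_ideal (A `|` K) /\ ~ (A `|` K) 1.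
have [|A [[Aid A1] Amax]] := @Zorn_bigcup _ P.
  move=> F FP Ftot.
  have sub2 x y : (\bigcup_(A in F) A `|` K) x -> (\bigcup_(A in F) A `|` K) y ->
      exists2 B, B = K \/ F B & (B `|` K) x /\ (B `|` K) y.
    move=> [[A FA Ax]|Kx] [[B FB By]|Ky].
    - by have [/(_ _ Ax)|/(_ _ By)] := Ftot _ _ FA FB => ?;
        [exists B|exists A]; [right|split; left|right|split; left].
    - by exists A; [right|split; [left|right]].
    - by exists B; [right|split; [right|left]].
    - by exists K; [left|split; right].
  have subU B : B = K \/ F B -> B `|` K `<=` \bigcup_(A in F) A `|` K.
    by move=> [->|FB] x []; [right|right|left; exists B|right].
  have PB B : B = K \/ F B -> P B.
    by move=> [->|/FP//]; rewrite /P setUid.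
  split; first split.
  - by right.
  - move=> x y Ux Uy; have [B FB [Bx By]] := sub2 _ _ Ux Uy.
    by apply: (subU B FB); have [[_ h _] _] := PB _ FB; apply: h.
  - move=> x a Ux; have [B FB [Bx _]] := sub2 _ _ Ux Ux.
    by apply: (subU B FB); have [[_ _ h] _] := PB _ FB; apply: h.
  - move=> U1; have [B FB [B1 _]] := sub2 _ _ U1 U1.
    by have [_] := PB _ FB.
exists (A `|` K); last by move=> x; right.
split=> // [AT|L Lid AKL]; first by apply: A1; rewrite AT.
have [L1|L1] := pselect (L 1); first by right; apply: right_ideal_setT.
left; have LK : L `|` K = L.
  by apply/seteqP; split=> x; [case=> // Kx; apply: AKL; right|left].
apply: contrapT => LA; apply: (Amax L); last by rewrite /P LK.
split=> [x Ax|LsA]; first by apply: AKL; left.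
by apply: LA; apply/seteqP; split=> // x /LsA; left.
Qed.

Definition rinv x := exists y, x * y = 1.

Lemma Jac_rinv x : x \in Jac R -> rinv (1 - x).
Proof.
move=> /asboolP Jx; apply: contrapT => nx.
pose K := [set (1 - x) * y | y in setT].
have [|[y _ y1]|M Mmax KM] := @maximal_right_ideal_above K.
- split; first by exists 0; rewrite ?mulr0.
    by move=> _ _ [y _ <-] [z _ <-]; exists (y - z); rewrite ?mulrBr.
  by move=> _ a [y _ <-]; exists (y * a); rewrite ?mulrA.
- by apply: nx; exists y.
case: (Mmax) => Mid MT _; apply: MT; apply: right_ideal_setT => //.
rewrite -(subrK x 1); apply: right_idealD => //; last exact: Jx.
by apply: KM; exists 1; rewrite ?mulr1.
Qed.

(** A right inverse [y] of [1 - x] equals [1 + x * y], hence is itself right invertible; as [1 - x]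
    is its left inverse, it is a unit. *)
Lemma Jac_unit x : x \in Jac R -> exists y, (1 - x) * y = 1 /\ y * (1 - x) = 1.
Proof.
move=> Jx; have [y xy] := Jac_rinv Jx; exists y; split=> //.
have [z yz] : rinv (1 - (- (x * y))).
  by apply: Jac_rinv; rewrite rpredN; apply: ideal_mulMr.
have yE : 1 - - (x * y) = y.
  by move/eqP: xy; rewrite mulrBl mul1r subr_eq opprK => /eqP <-.
rewrite yE in yz; suff -> : 1 - x = z by [].
by rewrite -[RHS]mul1r -{2}xy -mulrA yz mulr1.
Qed.

(** If a maximal right ideal [M] missed [x], then [M + xR] would contain [1], putting a right
    invertible element [1 - x * y] in [M]. *)
Lemma JacP x : (forall y, rinv (1 - x * y)) -> x \in Jac R.
Proof.
move=> h; apply/asboolP => M [[M0 MB MM] MT Mmax]; apply: contrapT => Mx.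
pose N := [set m + x * y | m in M & y in [set: R]].
have [||NM|NT] := Mmax N.
- split.
  + by exists 0 => //; exists 0 => //; rewrite mulr0 addr0.
  + move=> _ _ [m Mm [y _ <-]] [m' Mm' [y' _ <-]].
    exists (m - m'); first exact: MB.
    by exists (y - y') => //; rewrite mulrBr opprD addrACA.
  + move=> _ a [m Mm [y _ <-]]; exists (m * a); first exact: MM.
    by exists (y * a) => //; rewrite mulrDl mulrA.
- by move=> m Mm; exists m => //; exists 0 => //; rewrite mulr0 addr0.
- by apply: Mx; rewrite -NM; exists 0 => //; exists 1 => //; rewrite mulr1 add0r.
have [m Mm [y _ mE]] : N 1 by rewrite NT.
have [z xz] := h y; apply: MT; apply: right_ideal_setT => //.
by rewrite -xz -mE addrK; apply: MM.
Qed.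

Lemma Jac_idem0 e : e * e = e -> e \in Jac R -> e = 0.
Proof.
move=> ee /Jac_unit[y [ey _]].
by rewrite -[e]mulr1 -ey mulrA mulrBr mulr1 ee subrr mul0r.
Qed.

End Jacobson.

(* The Fitting decomposition of [a]: the corner [eae = ae] is invertible in
   [eRe], with inverse [b]. *)
Definition fitting (R : pzRingType) (a e b : R) : Prop :=
  [/\ e * e = e, a * e = e * a, e * b = b /\ b * e = b, a * b = e & b * a = e].

(** * Fitting decompositions and their uniqueness *)

Section Fitting.
Variable R : pzRingType.
Implicit Types (x y z a b e f : R).

Lemma comm_idemC a e : a * e = e * a -> (1 - e) * a = a * (1 - e).
Proof. by move=> ae; rewrite mulrBl mulrBr mul1r mulr1 ae. Qed.

Lemma idemC e : e * e = e -> (1 - e) * (1 - e) = 1 - e.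
Proof. by move=> ee; rewrite mulrBr mulr1 mulrBl mul1r ee subrr subr0. Qed.

Lemma fitting_exp a e b n : fitting a e b -> a ^+ n.+1 * b ^+ n.+1 = e.
Proof.
move=> [ee ae [eb be] ab ba]; elim: n => [|n IHn]; first by rewrite !expr1.
rewrite (exprS a) (exprSr b) mulrA -(mulrA a) IHn.
by rewrite ae -mulrA ab ee.
Qed.

Lemma fitting_comm a e b : fitting a e b -> a * b = b * a.
Proof. by case=> _ _ _ -> ->. Qed.

Lemma fitting_map (S : pzRingType) (f : {rmorphism R -> S}) a e b :
  fitting a e b -> fitting (f a) (f e) (f b).
Proof.
by move=> [ee ae [eb be] ab ba]; split; [| |split| |];
  rewrite -!rmorphM ?ee ?ae ?eb ?be ?ab ?ba.
Qed.

(** Nilpotence of [(1 - e') * a] modulo an ideal thereby forces [(1 - e') * e] and [e * (1 - e')]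
    into that ideal. It holds because [e] is [a ^+ n.+1 * b ^+ n.+1] and [1 - e'] commutes with
    [a]. *)
Lemma fitting_cross a e b e' b' n : fitting a e b -> fitting a e' b' ->
  (1 - e') * e = ((1 - e') * a) ^+ n.+1 * b ^+ n.+1 /\
  e * (1 - e') = b ^+ n.+1 * ((1 - e') * a) ^+ n.+1.
Proof.
move=> F F'; have [ee' ae' _ _ _] := F'.
have ca := comm_idemC ae'.
have -> : ((1 - e') * a) ^+ n.+1 = (1 - e') * a ^+ n.+1.
  rewrite exprMn_comm //; congr (_ * _).
  by elim: n => [|n IHn]; [rewrite expr1|rewrite exprS IHn idemC].
have -> : (1 - e') * a ^+ n.+1 * b ^+ n.+1 = (1 - e') * e.
  by rewrite -mulrA (fitting_exp n F).
split=> //; rewrite (commrX n.+1 ca) mulrA.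
have <- : a ^+ n.+1 * b ^+ n.+1 = b ^+ n.+1 * a ^+ n.+1.
  by apply: commrX; apply: commr_sym; apply: commrX; apply: esym (fitting_comm F).
by rewrite (fitting_exp n F).
Qed.

(* The topology only enters through families of (open) ideals. *)
Definition separated (F : set (ideal R)) : Prop :=
  forall x, (forall J : ideal R, F J -> x \in J) -> x = 0.

Definition topnil (F : set (ideal R)) x : Prop :=
  forall J : ideal R, F J -> exists n : nat, x ^+ n \in J.

Lemma idealX_le (J : ideal R) x m n : (m <= n)%N -> x ^+ m \in J -> x ^+ n \in J.
Proof. by move=> mn xm; rewrite -(subnK mn) exprD; apply: ideal_mulMl. Qed.

(** By [fitting_cross] each idempotent absorbs the other on both sides modulo every ideal of [F],
    hence exactly, so they agree; inverses in one corner are unique. *)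
Lemma fitting_uniq (F : set (ideal R)) a e b e' b' : separated F ->
  fitting a e b -> topnil F ((1 - e) * a) ->
  fitting a e' b' -> topnil F ((1 - e') * a) -> e = e' /\ b = b'.
Proof.
move=> sF fit nil fit' nil'.
have key x y z w : fitting a x y -> fitting a z w -> topnil F ((1 - z) * a) ->
    z * x = x /\ x * z = x.
  move=> Fx Fz nz; suff [h1 h2] : (1 - z) * x = 0 /\ x * (1 - z) = 0.
    split; apply/esym/eqP; rewrite -subr_eq0.
      by rewrite -[X in X - _]mul1r -mulrBl h1.
    by rewrite -[X in X - _]mulr1 -mulrBr h2.
  split; apply: sF => J FJ; have [n /(idealX_le (leqnSn n)) nJ] := nz J FJ;
    have [c1 c2] := fitting_cross n Fx Fz.
    by rewrite c1; apply: ideal_mulMr.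
  by rewrite c2; apply: ideal_mulMl.
have ee : e = e'.
  have [_ <-] := key _ _ _ _ fit fit' nil'.
  by have [-> _] := key _ _ _ _ fit' fit nil.
split=> //; rewrite -ee in fit' *.
have [_ _ [_ be] _ ba] := fit; have [_ _ [eb' _] ab' _] := fit'.
by rewrite -be -ab' mulrA ba.
Qed.

End Fitting.

(** * Pi-regular rings *)

Section PiRegular.
Variable R : pzRingType.
Implicit Types (x y z a b e : R).

Lemma pi_regular_exp a : pi_regular R ->
  exists n, forall m, (n <= m)%N -> exists b, a ^+ n.+1 = a ^+ m.+1 * b.
Proof.
move=> /(_ a)[n nP]; exists n => m /nP eqI.
have [b _ <-] : principal_right_ideal (a ^+ m.+1) (a ^+ n.+1); last by exists b.
by rewrite eqI; exists 1; rewrite ?mulr1.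
Qed.

Lemma pi_regularP :
  (forall a, exists n b, a ^+ n = a ^+ n.+1 * b) -> pi_regular R.
Proof.
move=> h a; have [n [b ab]] := h a; exists n => m nm.
have exps k : exists c, a ^+ n = a ^+ (n + k) * c.
  elim: k => [|k [c ac]]; first by exists 1; rewrite addn0 mulr1.
  by exists (b * c); rewrite {1}ac addnC exprD {1}ab -addSnnS addnC exprD !mulrA.
apply/seteqP; split=> _ [r _ <-].
  exists (a ^+ (m - n) * r) => //.
  by rewrite mulrA -exprD addSn subnKC.
have [c ac] := exps (m - n)%N; rewrite subnKC // in ac.
by exists (c * r) => //; rewrite mulrA !exprS -(mulrA a (a ^+ m)) -ac.
Qed.

(* Dischinger's theorem: right strong pi-regularity of all elements makes a
   power of each element strongly regular. *)
Lemma pi_regular_group_inverse a : pi_regular R ->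
  exists n e b, fitting (a ^+ n.+1) e b /\ e * a ^+ n.+1 = a ^+ n.+1.
Proof.
move=> Rpi.
have [N hN] := pi_regular_exp a Rpi.
(* The exponent doubles [N.+1], so that [A0 = A0 * A0 * x]; the same is done for [x] below. Powers
   of [A0] and [x] then give [A = A * A * X] and [X = X * X * Y]. *)
have [x aN] := hN (N + N.+1)%N (leq_addr _ _).
set A0 := a ^+ N.+1 in aN; rewrite -addSn exprD -/A0 in aN.
have [M hM] := pi_regular_exp x Rpi.
have [Y xM] := hM (M + M.+1)%N (leq_addr _ _).
rewrite -addSn exprD in xM.
pose A := A0 ^+ M.+1; pose X := x ^+ M.+1.
have AAX : A * A * X = A.
  have h k : A0 ^+ k.+1 * x ^+ k = A0.
    elim: k => [|k IHk]; first by rewrite expr1 expr0 mulr1.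
    rewrite 2!(exprSr A0) (exprS x) mulrA -(mulrA _ A0 A0) -(mulrA _ (A0 * A0)).
    by rewrite -aN -exprSr.
  by rewrite /A /X -exprD addSnnS exprD -mulrA h -exprSr.
have XXY : X * X * Y = X by rewrite -xM.
have AXY : A * X * Y = A by rewrite -[in LHS]AAX -!mulrA (mulrA X) XXY mulrA AAX.
have AY : A * Y = A * A by rewrite -{1}AAX -!mulrA (mulrA A X) AXY.
(* Since [A * X * Y = A], the goal [A * X * A = A] amounts to [A * X * D = 0]. All
   [X ^+ k.+1 * D ^+ k.+1] equal [X * D], so pi-regularity of [D] gives [X * D = X * Y * D * Z], and
   [A * X * D] becomes [A * D * Z = 0]. *)
pose D := Y - A.
have AD : A * D = 0 by rewrite mulrBr AY subrr.
have DD : D * D = Y * D by rewrite {1}/D mulrBl AD subr0.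
have AXA : A * X * A = A.
  have XDk k : X * D = X ^+ k.+1 * D ^+ k.+1.
    elim: k => [|k IHk]; first by rewrite !expr1.
    rewrite IHk (exprS D k.+1) (exprS D k) (mulrA D D) DD -!(mulrA Y).
    rewrite (exprSr X k.+1) (exprSr X k) -!mulrA; congr (_ * _).
    by rewrite (mulrA X Y) (mulrA X (X * Y)) (mulrA X X Y) XXY.
  have [k hk] := pi_regular_exp D Rpi.
  have [Z DZ] := hk k.+1 (leqnSn _).
  have XD : X * D = X * Y * D * Z.
    by rewrite (XDk k) DZ (exprSr D k.+1) !mulrA -(XDk k) -(mulrA X) DD mulrA.
  have AXD : A * X * D = 0.
    by rewrite -mulrA XD !mulrA AXY AD mul0r.
  by apply/eqP; rewrite eq_sym -subr_eq0 -{1}AXY -mulrBr AXD.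
have [e eE] : exists e, e = A * X by exists (A * X).
have ee : e * e = e by rewrite eE mulrA AXA.
have Ae : A * e = A by rewrite eE mulrA.
have eA : e * A = A by rewrite eE.
have [b bE] : exists b, b = e * X * e by exists (e * X * e).
have eb : e * b = b by rewrite bE !mulrA ee.
have be : b * e = b by rewrite bE -(mulrA (e * X)) ee.
have Ab : A * b = e by rewrite bE !mulrA Ae -eE ee.
have Abk k : A ^+ k.+1 * b ^+ k.+1 = e.
  elim: k => [|k IHk]; first by rewrite !expr1.
  by rewrite exprSr (exprS b) mulrA -(mulrA _ A) Ab exprSr -(mulrA _ A) Ae -exprSr.
(* So far [b] is only a right inverse of [A] in the corner of [e]. Pi-regularity of [b] provides a
   right inverse [r] of [b] there, which makes [b] two-sided. *)
have [k hk] := pi_regular_exp b Rpi.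
have [r br] := hk k.+1 (leqnSn _).
have brE : b * r = e by rewrite -(Abk k) br (exprSr b) !mulrA Abk eb.
have bA : b * A = e.
  by rewrite -{1}Ae -brE (mulrA A) Ab mulrA be.
exists (N + M * N.+1)%N, e, b.
rewrite -addSn -mulSn mulnC exprM -/A0 -/A.
by split=> //; split; rewrite ?Ae ?eA.
Qed.

(** As [a] commutes with its power [A], both [a * e] and [e * a] equal [e * a * e]. On the
    complement, [((1 - e) * a) ^+ n.+1] is [(1 - e) * A], which vanishes. *)
Lemma fitting_root n a e b : fitting (a ^+ n.+1) e b ->
  e * a ^+ n.+1 = a ^+ n.+1 ->
  fitting a e (a ^+ n * b) /\ ((1 - e) * a) ^+ n.+1 = 0.
Proof.
set A := a ^+ n.+1 => -[ee Ae [eb be] Ab bA] eA.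
have aA : a * A = A * a by rewrite /A -exprS exprSr.
have ae : a * e = e * a.
  transitivity (e * a * e).
    by rewrite -{1}Ab mulrA aA -{1}eA -!mulrA (mulrA A) -aA -(mulrA a) Ab.
  by rewrite -{3}bA -(mulrA b) -aA mulrA -{1}eA -Ae mulrA -(mulrA b a A) aA mulrA bA.
have anb : a ^+ n * b = b * a ^+ n.
  have ea k : e * a ^+ k = a ^+ k * e by apply: commrX.
  have Aan : A * a ^+ n = a ^+ n * A by rewrite /A -!exprD addnC.
  transitivity (b * A * a ^+ n * b).
    by rewrite bA ea -mulrA eb.
  by rewrite -(mulrA b) Aan !mulrA -!(mulrA _ A) Ab -mulrA -ea mulrA be.
split; last first.
  rewrite exprMn_comm; last exact: comm_idemC.
  have -> : (1 - e) ^+ n.+1 = 1 - e.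
    by elim: n {A Ae Ab bA eA aA anb} => [|n IHn]; rewrite ?expr1 // exprS IHn idemC.
  by rewrite mulrBl mul1r -/A eA subrr.
split=> //; last by rewrite anb -mulrA -exprSr.
  by split; [rewrite anb mulrA eb|rewrite -mulrA be].
by rewrite mulrA -exprS.
Qed.

Lemma pi_regular_fitting a : pi_regular R ->
  exists e b n, fitting a e b /\ ((1 - e) * a) ^+ n = 0.
Proof.
move=> Rpi; have [n [e [b [F eA]]]] := pi_regular_group_inverse a Rpi.
by have [F' nil] := fitting_root F eA; exists e, (a ^+ n * b), n.+1.
Qed.

(** Taken as the only member of the family, this ideal turns [topnil] into nilpotence, so that the
    discrete and the topological cases share their lemmas. *)
Definition zero_ideal : ideal R := rker (idfun : {rmorphism R -> R}).

Lemma zero_idealE x : (x \in zero_ideal) = (x == 0).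
Proof. by []. Qed.

Lemma separated_zero : separated [set zero_ideal].
Proof. by move=> x /(_ _ erefl)/eqP. Qed.

(** The corner form of strong cleanness: [x] is invertible on the corner of [e], and [1 - x] on that
    of [1 - e], because [1 - (1 - e) * x = e + (1 - e) * (1 - x)]. *)
Definition strongly_clean : Prop := forall x, exists e b c,
  fitting x e b /\ c * (1 - (1 - e) * x) = 1 /\ (1 - (1 - e) * x) * c = 1.

Definition quasi_fitting (F : set (ideal R)) : Prop := forall x,
  exists e b, fitting x e b /\ topnil F ((1 - e) * x).

Lemma pi_regular_quasi_fitting : pi_regular R -> quasi_fitting [set zero_ideal].
Proof.
move=> Rpi x; have [e [b [n [F n0]]]] := pi_regular_fitting x Rpi.
by exists e, b; split=> // _ ->; exists n; rewrite n0 rpred0.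
Qed.

(** With [y = (1 - e) * x] and [g] the idempotent of [1 - y], both [y] and [1 - y] are topologically
    nilpotent on the corner of [1 - g]. They commute and add up to [1], so that corner is zero and
    [1 - y] is a unit. *)
Lemma quasi_fitting_strongly_clean (F : set (ideal R)) :
  separated F -> quasi_fitting F -> strongly_clean.
Proof.
move=> sF qF x; have [e [b [Fx nx]]] := qF x.
set y := (1 - e) * x in nx.
have [g [c [Fy ny]]] := qF (1 - y).
suff g1 : 1 - g = 0.
  have {}g1 : g = 1 by move/eqP: g1; rewrite subr_eq0 => /eqP.
  by exists e, b, c; case: Fy => _ _ _; rewrite g1.
apply: sF => J FJ.
have [n {}nx] := nx J FJ; have [m {}ny] := ny J FJ.
have [gg gy _ _ _] := Fy.
have cg : (1 - g) * (1 - y) = (1 - y) * (1 - g) by apply: comm_idemC.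
have gX k : (1 - g) ^+ k.+1 = 1 - g.
  by elim: k => [|k IHk]; rewrite ?expr1 // exprS IHk idemC.
have {}ny : (1 - g) * (1 - y) ^+ m.+1 \in J.
  by rewrite -{1}(gX m) -exprMn_comm //; apply: idealX_le ny; rewrite leqnSn.
have c1y : GRing.comm y (1 - y) by rewrite /GRing.comm mulrBl mulrBr mul1r mulr1.
(* With exponent [n + m.+1], every binomial term contains [y ^+ n] or [(1 - y) ^+ m.+1]. *)
have -> : 1 - g = (1 - g) * (y + (1 - y)) ^+ (n + m.+1).
  by rewrite (addrC y) subrK expr1n mulr1.
rewrite exprDn_comm // mulr_sumr; apply: rpred_sum => i _.
rewrite mulrnAr; apply: rpredMn.
have [ni|ni] := leqP i m.
  apply: ideal_mulMl; apply: ideal_mulMr; apply: idealX_le nx.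
  by rewrite -addnBA ?leq_addr // leqW.
rewrite commrX; last by apply: commr_sym; apply: commrX.
rewrite mulrA; apply: ideal_mulMr.
by rewrite -(subnKC ni) exprD mulrA; apply: ideal_mulMr.
Qed.

End PiRegular.

(** * The maximum condition on idempotents *)

Lemma dependent_choice_seq (T : Type) (P : set T) (r : T -> T -> Prop) :
  P !=set0 -> (forall x, P x -> exists y, P y /\ r x y) ->
  exists u : nat -> T, forall n, P (u n) /\ r (u n) (u n.+1).
Proof.
move=> [x0 Px0] h.
have step (x : {x | P x}) : {y : {x | P x} | r (sval x) (sval y)}.
  by apply: cid; have [y [Py rxy]] := h _ (svalP x); exists (exist _ y Py).
have [f [_ fP]] := dependent_choice step (exist _ x0 Px0).
by exists (fun n => sval (f n)) => n; split; [apply: svalP|apply: fP].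
Qed.

(** Maximality refers to the order in which [e] lies below [e'] when [e * e' = e = e' * e]. *)
Definition acc_idem (R : pzRingType) : Prop := forall P : set R, P !=set0 ->
  (forall e, P e -> e * e = e) ->
  exists2 e, P e & forall e', P e' -> e * e' = e -> e' * e = e -> e' = e.

Lemma acc_idem_inj (A B : pzRingType) (f : {rmorphism A -> B}) :
  injective f -> acc_idem B -> acc_idem A.
Proof.
move=> finj acc P [x Px] Pid.
have [||_ [e Pe <-] emax] := acc (f @` P).
- by exists (f x), x.
- by move=> _ [e Pe <-]; rewrite -rmorphM Pid.
exists e => // e' Pe' ee' e'e; apply: finj; apply: emax; first by exists e'.
  by rewrite -rmorphM ee'.
by rewrite -rmorphM e'e.
Qed.

(** Without a maximal element there is a strictly increasing sequence of idempotents; its successive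
    differences are nonzero orthogonal idempotents. *)
Lemma acc_idem_orthogonal (R : pzRingType) :
  ~ (exists E : set R, infinite_set E /\ orthogonal_idempotents E) -> acc_idem R.
Proof.
move=> noE P P0 Pid; apply: contrapT => nmax; apply: noE.
have [|u uP] := @dependent_choice_seq R P
    (fun e e' => [/\ e * e' = e, e' * e = e & e' <> e]) P0.
  move=> e Pe; apply: contrapT => h; apply: nmax; exists e => // e' Pe' h1 h2.
  by apply: contrapT => h3; apply: h; exists e'.
have u_le m n : (m <= n)%N -> u m * u n = u m /\ u n * u m = u m.
  move=> /subnKC <-; elim: (n - m)%N => [|k [IH1 IH2]].
    by rewrite addn0 Pid //; case: (uP m).
  have [_ [h1 h2 _]] := uP (m + k)%N; rewrite addnS; split.
    by rewrite -{1}IH1 -mulrA h1 IH1.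
  by rewrite -{1}IH2 mulrA h2 IH2.
pose g n := u n.+1 - u n.
have gg n : g n * g n = g n.
  have [Pn [h1 h2 _]] := uP n; have [Pn1 _] := uP n.+1.
  by rewrite /g mulrBr !mulrBl h1 h2 !Pid // subrr subr0.
have g0 n : g n <> 0.
  by move=> /eqP; rewrite subr_eq0 => /eqP; have [_ []] := uP n.
have g_lt m n : (m < n)%N -> g m * g n = 0 /\ g n * g m = 0.
  move=> mn; have [h1 h2] := u_le _ _ mn; have [h3 h4] := u_le _ _ (ltnW mn).
  have [h5 h6] := u_le _ _ (leqW mn); have [h7 h8] := u_le _ _ (leqW (ltnW mn)).
  by rewrite /g !mulrBr !mulrBl h1 h2 h3 h4 h5 h6 h7 h8 !subrr.
have ginj m n : g m = g n -> m = n.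
  move=> gmn; have [mn|nm|//] := ltngtP m n.
    by have [] := g_lt _ _ mn; rewrite -gmn gg => /g0.
  by have [] := g_lt _ _ nm; rewrite -gmn gg => /g0.
exists (range g); split; last split.
- move=> /(finite_preimage (in2W ginj)); rewrite preimage_range.
  exact: infinite_nat.
- by move=> _ [n _ <-].
- move=> _ _ [m _ <-] [n _ <-] mn.
  have [/g_lt[]//|/g_lt[]//|mnE] := ltngtP m n.
  by rewrite mnE in mn.
Qed.

Section SemilocalAcc.
Variable R : pzRingType.

Lemma right_artinian_min (F : set (set R)) : right_artinian R -> F !=set0 ->
  (forall K, F K -> right_ideal K) ->
  exists2 K, F K & forall L, F L -> L `<=` K -> L = K.
Proof.
move=> art F0 Fid; apply: contrapT => nmin.
have [|u uP] := @dependent_choice_seq _ F (fun K L => L `<=` K /\ L <> K) F0.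
  move=> K FK; apply: contrapT => h; apply: nmin; exists K => // L FL LK.
  by apply: contrapT => h'; apply: h; exists L.
have [n|n|n /(_ _ (leqnSn n)) un] := art u.
- by apply: Fid; case: (uP n).
- by case: (uP n) => _ [].
- by case: (uP n) => _ [].
Qed.

Lemma principal_right_ideal_id (a : R) : right_ideal (principal_right_ideal a).
Proof.
split; first by exists 0; rewrite ?mulr0.
  by move=> _ _ [y _ <-] [z _ <-]; exists (y - z); rewrite ?mulrBr.
by move=> _ b [y _ <-]; exists (y * b); rewrite ?mulrA.
Qed.

End SemilocalAcc.

(** Take [e] for which [1 - e] generates a minimal right ideal modulo the radical. If [e'] lies
    above [e], both complements generate the same ideal, so the idempotent [e' - e] lies in the
    radical and vanishes. *)
Lemma semilocal_acc_idem (R : pzRingType) : semilocal R -> acc_idem R.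
Proof.
move=> [art _] P [e0 Pe0] Pid; set J : ideal R := Jac R in art.
have [||_ [e Pe <-] emin] := @right_artinian_min _
  [set principal_right_ideal (quot_pi J (1 - e)) | e in P] art.
- by exists (principal_right_ideal (quot_pi J (1 - e0))), e0.
- by move=> _ [e _ <-]; apply: principal_right_ideal_id.
exists e => // e' Pe' ee' e'e.
have eqI : principal_right_ideal (quot_pi J (1 - e')) =
    principal_right_ideal (quot_pi J (1 - e)).
  apply: emin; first by exists e'.
  move=> _ [x _ <-]; exists (quot_pi J (1 - e') * x) => //; rewrite mulrA -rmorphM.
  by rewrite mulrBl mul1r (mulrBr e) mulr1 ee' subrr subr0.
have [x _ xE] : principal_right_ideal (quot_pi J (1 - e')) (quot_pi J (1 - e)).
  by rewrite eqI; exists 1; rewrite ?mulr1.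
have : quot_pi J (e' * (1 - e)) = quot_pi J 0.
  rewrite rmorphM /= -xE mulrA -rmorphM mulrBr mulr1 (Pid e') // subrr rmorph0.
  by rewrite mul0r ?rmorph0.
move/eqP; rewrite quot_piP subr0 mulrBr mulr1 e'e => eJ.
apply/eqP; rewrite -subr_eq0; apply/eqP; apply: Jac_idem0 => //.
by rewrite mulrBr !mulrBl ee' e'e !Pid // subrr subr0.
Qed.

(** * Strongly clean rings with finitely many orthogonal idempotents *)

Section StronglyCleanAcc.
Variable R : pzRingType.
Hypothesis Rsc : strongly_clean R.
Implicit Types (x y z a k e f g : R) (K L W : set R).

(** If [xR] held no nonzero idempotent, the idempotent of every [x * y] would be [0], making each
    [1 - x * y] a unit. *)
Lemma idem_of_notin_Jac x : x \notin Jac R ->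
  exists w, [/\ x * w != 0 & x * w * (x * w) = x * w].
Proof.
move=> xJ; apply: contrapT => nx; move/negP: xJ; apply; apply: JacP => y.
have [e [b [c [[ee _ _ xb _] [_ xc]]]]] := Rsc (x * y).
have e0 : e = 0.
  apply: contrapT => /eqP e0; apply: nx; exists (y * b).
  by rewrite (mulrA x) xb.
by exists c; rewrite e0 subr0 mul1r in xc.
Qed.

Lemma idem_extend e e' K k :
  e * e = e -> e' * e' = e' -> e * e' = e -> e' * e = e ->
  right_ideal K -> K e -> K k -> e' * k = k -> (1 - e) * k \notin Jac R ->
  exists g, [/\ g * g = g, g != 0, e * g = 0 /\ g * e = 0,
                e' * g = g /\ g * e' = g & K g].
Proof.
move=> ee e'e' ee' e'e [K0 KB KM] Ke Kk e'k /idem_of_notin_Jac[w].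
set h := (1 - e) * k * w => -[h0 hh].
have eh : e * h = 0 by rewrite /h !mulrA mulrBr mulr1 ee subrr !mul0r.
have Kh : K h.
  by apply: (KM); rewrite mulrBl mul1r; apply: (KB) => //; apply: KM.
have e'h : e' * h = h.
  by rewrite /h !mulrA mulrBr mulr1 e'e mulrBl e'k [in RHS]mulrBl mul1r.
(* The idempotent [h] satisfies only [e * h = 0]; the factor [e' - e], which fixes [h] from the
   left, also kills [e] on the right and keeps the result below [e']. *)
exists (h * (e' - e)); split; [|apply/eqP => g0|split|split|exact: KM].
- by rewrite mulrA -(mulrA h _ h) mulrBl e'h eh subr0 hh.
- move/eqP: h0; apply; rewrite -hh -{2}e'h -[e' * h]subr0 -eh -mulrBl mulrA g0.
  by rewrite mul0r.
- by rewrite mulrA eh mul0r.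
- by rewrite -mulrA mulrBl e'e ee subrr mulr0.
- by rewrite mulrA e'h.
- by rewrite -mulrA mulrBl e'e' ee'.
Qed.

Hypothesis Racc : acc_idem R.

Definition generates_mod_Jac K e : Prop :=
  [/\ e * e = e, K e & forall k, K k -> k - e * k \in Jac R].

(** A maximal idempotent of [K] below [e'] works: otherwise [idem_extend] gives a [g] and [e + g] is
    larger. The bound [e'] allows compatible generators for nested ideals. *)
Lemma right_ideal_idem K e' : right_ideal K -> [set` Jac R] `<=` K ->
  e' * e' = e' -> (forall k, K k -> k - e' * k \in Jac R) ->
  exists e, [/\ generates_mod_Jac K e, e * e' = e & e' * e = e].
Proof.
move=> Kid JK e'e' Ke'; have [K0 KB KM] := Kid.
pose P e := [/\ e * e = e, K e, e * e' = e & e' * e = e].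
have [||e [ee Ke ee' e'e] emax] := Racc (P := P).
- by exists 0; split; rewrite ?mulr0 ?mul0r.
- by move=> e [].
exists e; split=> //; split=> // k Kk; apply: contraPT isT => kJ.
have [|||g [gg /eqP g0 [eg ge] [e'g ge'] Kg]] :=
    @idem_extend e e' K (e' * k) ee e'e' ee' e'e Kid Ke.
- by rewrite -[e' * k](subKr k); apply: (KB) => //; apply: JK; apply: Ke'.
- by rewrite mulrA e'e'.
- apply: contra kJ; rewrite mulrBl mul1r mulrA ee' => kJ.
  have -> : k - e * k = (k - e' * k) + (e' * k - e * k) by rewrite addrA subrK.
  by apply: rpredD; first exact: Ke'.
exfalso; apply: g0; apply: (addrI e); rewrite addr0; apply: emax.
- split; rewrite ?mulrDl ?mulrDr ?ee ?eg ?ge ?gg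
    ?addr0 ?add0r ?ee' ?e'e ?e'g ?ge' //.
  exact: right_idealD.
- by rewrite mulrDr ee eg addr0.
- by rewrite mulrDl ee ge addr0.
Qed.

Lemma right_ideal_idem1 K : right_ideal K -> [set` Jac R] `<=` K ->
  exists e, generates_mod_Jac K e.
Proof.
move=> Kid JK; have [||e []] := @right_ideal_idem K 1 Kid JK.
- by rewrite mulr1.
- by move=> k _; rewrite mul1r subrr rpred0.
by move=> he _ _; exists e.
Qed.

(** The maximum condition applies to complements of generators: a smaller [L] has a generator below
    [1 - f], whose complement lies above the maximal [f] and so equals it. *)
Lemma right_ideal_min (F : set (set R)) : F !=set0 ->
  (forall K, F K -> right_ideal K /\ [set` Jac R] `<=` K) ->
  exists2 K, F K & forall L, F L -> L `<=` K -> L = K.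
Proof.
move=> [K0 FK0] Fid.
pose P f := exists K, F K /\ generates_mod_Jac K (1 - f).
have sub1K x : 1 - (1 - x) = x by rewrite opprB addrC subrK.
have [||f [K [FK Kf]] fmax] := Racc (P := P).
- have [Kid JK] := Fid _ FK0; have [e he] := right_ideal_idem1 Kid JK.
  by exists (1 - e), K0; rewrite sub1K.
- by move=> f [K [_ [ff _ _]]]; rewrite -(sub1K f) idemC.
exists K => // L FL LK; apply/seteqP; split=> // k Kk.
have [Lid JL] := Fid _ FL; have [Kid JK] := Fid _ FK.
case: (Kf) => ff Kf1 Kk'.
have [|e [Le ef fe]] := right_ideal_idem Lid JL ff.
  by move=> x /LK/Kk'.
have fe0 : f * e = 0.
  move/eqP: fe; rewrite mulrBl mul1r -subr_eq0 addrAC subrr add0r oppr_eq0.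
  by move/eqP.
have ef0 : e * f = 0.
  move/eqP: ef; rewrite mulrBr mulr1 -subr_eq0 addrAC subrr add0r oppr_eq0.
  by move/eqP.
have e1 : 1 - e = f.
  apply: fmax; first by exists L; rewrite sub1K.
  - by rewrite mulrBr mulr1 fe0 subr0.
  - by rewrite mulrBl mul1r ef0 subr0.
case: Le => _; rewrite -[e]sub1K e1 => Lf _.
have -> : k = (k - (1 - f) * k) + (1 - f) * k by rewrite subrK.
apply: right_idealD => //.
  by apply: JL; apply: Kk'.
by case: Lid => _ _; apply.
Qed.

(** The idempotent of the decomposition of [x] works: [e - x = e * (1 - x) - (1 - e) * x], where [e]
    is a multiple of [x] and [1 - e] one of [1 - x]. *)
Lemma strongly_clean_lift x : x * x - x \in Jac R ->
  exists e, e * e = e /\ e - x \in Jac R.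
Proof.
move=> xJ; have [e [b [c [[ee xe [eb be] xb bx] [_ xc]]]]] := Rsc x.
exists e; split=> //.
have -> : e - x = e * (1 - x) - (1 - e) * x.
  by rewrite mulrBr mulrBl mulr1 mul1r opprB addrA addrNK.
apply: rpredB.
  rewrite -{1}bx -mulrA; apply: ideal_mulMl.
  by rewrite mulrBr mulr1 -rpredN opprB.
have fE : 1 - e = (1 - x) * ((1 - e) * c).
  have xC : (1 - x) * (1 - e) = (1 - e) * (1 - x).
    by rewrite (mulrBl (1 - e)) (mulrBr (1 - e)) mul1r mulr1 (comm_idemC xe).
  rewrite mulrA xC.
  have -> : (1 - e) * (1 - x) = (1 - e) * (1 - (1 - e) * x).
    by rewrite !mulrBr mulrA idemC.
  by rewrite -mulrA xc mulr1.
rewrite (comm_idemC xe) fE (mulrA x); apply: ideal_mulMr.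
by rewrite mulrBr mulr1 -rpredN opprB.
Qed.

Lemma Jac_quot_Jac0 (x : ring_quot (Jac R : ideal R)) : x \in Jac _ -> x = 0.
Proof.
rewrite -[x]quot_piW; set y := repr x => yJ.
apply/eqP; rewrite -(rmorph0 (quot_pi _)) quot_piP subr0; apply: JacP => z.
have [] : rinv (1 - quot_pi (Jac R : ideal R) y * quot_pi _ z).
  by apply: Jac_rinv; apply: ideal_mulMr.
move=> t; rewrite -[t]quot_piW -rmorphM -(rmorph1 (quot_pi _)) -rmorphB -rmorphM /=.
set s := repr t => /eqP; rewrite quot_piP -rpredN opprB => /Jac_rinv[u].
by rewrite subKr => su; exists (s * u); rewrite mulrA.
Qed.

Lemma right_ideal_preimage (K : set (ring_quot (Jac R : ideal R))) :
  right_ideal K -> right_ideal (quot_pi _ @^-1` K) /\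
                   [set` Jac R] `<=` quot_pi _ @^-1` K.
Proof.
move=> [K0 KB KM]; split; first split.
- by rewrite /= rmorph0.
- by move=> x y /= Kx Ky; rewrite rmorphB; apply: KB.
- by move=> x a /= Kx; rewrite rmorphM; apply: KM.
move=> x /= xJ; suff -> : quot_pi (Jac R : ideal R) x = 0 by [].
by apply/eqP; rewrite -(rmorph0 (quot_pi _)) quot_piP subr0.
Qed.

Lemma strongly_clean_semiperfect : semiperfect R.
Proof.
split; last exact: strongly_clean_lift.
split; last exact: Jac_quot_Jac0.
move=> K Kid Kdecr.
have [||_ [n _ <-] nmin] := @right_ideal_min
    (range (fun n => quot_pi (Jac R : ideal R) @^-1` K n)).
- by exists (quot_pi (Jac R : ideal R) @^-1` K 0%N), 0%N.
- by move=> _ [n _ <-]; apply: right_ideal_preimage.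
have Kle m : (n <= m)%N -> K m `<=` K n.
  move/subnKC <-; elim: (m - n)%N => [|k IHk]; first by rewrite addn0.
  by rewrite addnS; apply: subset_trans (Kdecr _) IHk.
exists n => m nm; apply/seteqP; split; first exact: Kle.
move=> x; rewrite -[x]quot_piW => Kx.
have : (quot_pi (Jac R : ideal R) @^-1` K n) (repr x) by [].
by rewrite -(nmin (quot_pi (Jac R : ideal R) @^-1` K m)) // => y; apply: Kle.
Qed.

End StronglyCleanAcc.

(** * Levitzki's theorem modulo the radical *)

Fixpoint words (R : pzRingType) (N : set R) (n : nat) : set R :=
  if n is m.+1 then [set p * y | p in words N m & y in N] else [set 1].

Section Levitzki.
Variables (R : pzRingType) (N : set R).
Hypotheses (Rsc : strongly_clean R) (Racc : acc_idem R).
Hypothesis NM : forall x y, N x -> N y -> N (x * y).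
Hypothesis Nnil : forall x, N x -> exists n, x ^+ n \in Jac R.
Implicit Types (x y k p q : R) (K W : set R).

(** The right annihilator of the [n]-fold products modulo the radical; the theorem amounts to [1]
    lying in some [W_ n]. *)
Let W_ n : set R := [set q | forall p, words N n p -> p * q \in Jac R].

Let W_stable n y q : N y -> W_ n q -> W_ n (y * q).
Proof.
case: n => [|n] Ny Wq p /=.
  by move=> ->; rewrite mul1r; apply: ideal_mulMl; rewrite -[q]mul1r; apply: Wq.
move=> [p' p'N [y' Ny' <-]]; rewrite -mulrA (mulrA y') mulrA; apply: Wq.
by exists p' => //; exists (y' * y) => //; apply: NM.
Qed.

Let W_le m n : (m <= n)%N -> W_ m `<=` W_ n.
Proof.
move/subnKC <-; elim: (n - m)%N => [|k IHk]; first by rewrite addn0.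
rewrite addnS; apply: subset_trans IHk _ => q Wq _ [p pN [y Ny <-]].
by rewrite -mulrA; apply: W_stable pN.
Qed.

Let W : set R := \bigcup_n W_ n.

Let W_right_ideal : right_ideal W.
Proof.
split.
- by exists 0%N => // p _; rewrite mulr0 rpred0.
- move=> x y [m _ Wx] [n _ Wy]; exists (maxn m n) => // p pN; rewrite mulrBr.
  apply: rpredB; first exact: (W_le (leq_maxl m n) Wx).
  exact: (W_le (leq_maxr m n) Wy).
- by move=> x a [n _ Wx]; exists n => // p /Wx; rewrite mulrA; apply: ideal_mulMr.
Qed.

Let Jac_W : [set` Jac R] `<=` W.
Proof. by move=> x Jx; exists 0%N => // p _; apply: ideal_mulMl. Qed.

(** An idempotent generating the union modulo the radical already lies in one [W_ n], which is then
    the whole union. *)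
Let W_uniform : exists n, W = W_ n.
Proof.
have [e [ee [n _ We] We']] := right_ideal_idem1 Rsc Racc W_right_ideal Jac_W.
exists n; apply/seteqP; split=> [k Wk|k Wk]; last by exists n.
move=> p pN; have -> : k = e * k + (k - e * k) by rewrite addrC subrK.
rewrite mulrDr mulrA; apply: rpredD; first by apply: ideal_mulMr; apply: We.
by apply: ideal_mulMl; apply: We'.
Qed.

Let W_closed q : (forall y, N y -> W (y * q)) -> W q.
Proof.
have [n WE] := W_uniform; rewrite {1}WE => h; exists n.+1 => // _ [p pN [y Ny <-]].
by rewrite -mulrA; apply: h pN.
Qed.

(* Levitzki's argument: were [1] not in [W], take a minimal [N]-stable right
   ideal [K] strictly above [W], and [x] in [N] with [xK + W] minimal above [W].
   As [N] is nil, [xyxK] lies in [W] for all [y], so the [q] in [K] with [xq] and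
   [xNq] in [W] form an [N]-stable right ideal containing [xK]; by minimality it
   is [K], whence [xK] lies in [W]. *)
Lemma nil_semigroup_nilpotent : exists n, words N n `<=` [set` Jac R].
Proof.
suff [n _ W1] : W 1 by exists n => p /W1; rewrite mulr1.
apply: contrapT => nW1; have [W0 WB WM] := W_right_ideal.
have W_st y q : N y -> W q -> W (y * q).
  by move=> Ny [n _ Wq]; exists n => //; apply: W_stable.
pose F K := [/\ right_ideal K, W `<=` K, (forall y k, N y -> K k -> K (y * k))
  & ~ K `<=` W].
have [||K [Kid WK Kst KW] Kmin] := @right_ideal_min R Rsc Racc F.
- by exists setT; split=> // h; apply: nW1; apply: h.
- by move=> K [Kid WK _ _]; split=> //; apply: subset_trans Jac_W WK.
have [K0 KB KM] := Kid.
pose xKW x : set R := [set x * k + w | k in K & w in W].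
have xKW_sub x : W `<=` xKW x.
  by move=> w Ww; exists 0 => //; exists w => //; rewrite mulr0 add0r.
have xKW_id x : right_ideal (xKW x).
  split; first exact: xKW_sub.
    move=> _ _ [k Kk [w Ww <-]] [k' Kk' [w' Ww' <-]].
    exists (k - k'); first exact: KB.
    by exists (w - w'); [apply: WB|rewrite mulrBr opprD addrACA].
  move=> _ a [k Kk [w Ww <-]]; exists (k * a); first exact: KM.
  by exists (w * a); [apply: WM|rewrite mulrDl mulrA].
pose G := [set xKW x | x in [set x | N x /\ ~ forall k, K k -> W (x * k)]].
have [||_ [x [Nx xK] <-] xmin] := @right_ideal_min R Rsc Racc G.
- apply: contrapT => G0; apply: KW => k Kk; apply: W_closed => y Ny.
  apply: contrapT => nW; apply: G0; exists (xKW y), y => //; split=> // h.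
  by apply: nW; apply: h.
- move=> _ [x _ <-]; split=> //; apply: subset_trans Jac_W _; exact: xKW_sub.
(* Otherwise minimality gives [zxK + W = xK + W]. Iterating, [xK] lies in [z ^+ m * xK + W] for all
   [m], hence in [W] since [z] is nil modulo the radical. It serves for [t = 1] and for [t] in
   [N]. *)
have xyx z : N z -> (exists2 t, z = x * t & forall k, K k -> K (t * k)) ->
    forall k, K k -> W (z * x * k).
  move=> Nz [t zE tK]; apply: contrapT => nW.
  have zxE : xKW (z * x) = xKW x.
    apply: xmin; first by exists (z * x) => //; split=> //; apply: NM.
    move=> _ [k Kk [w Ww <-]]; exists (t * (x * k)).
      by apply: tK; apply: Kst.
    by exists w => //; rewrite zE !mulrA.
  have zmx m k : K k -> exists2 k', K k' & W (x * k - z ^+ m * x * k').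
    elim: m k => [|m IHm] k Kk.
      by exists k => //; rewrite expr0 mul1r subrr.
    have [k' Kk' Wk'] := IHm k Kk.
    have [k2 Kk2 [w Ww kE]] : xKW (z * x) (x * k').
      by rewrite zxE; exists k' => //; exists 0 => //; rewrite addr0.
    exists k2 => //.
    have -> : x * k - z ^+ m.+1 * x * k2 = (x * k - z ^+ m * x * k') + z ^+ m * w.
      by rewrite -(mulrA _ x k') -kE mulrDr exprSr !mulrA opprD addrA subrK.
    apply: right_idealD => //.
    elim: m {IHm Wk'} => [|m IHm]; first by rewrite expr0 mul1r.
    by rewrite exprS -mulrA; apply: W_st.
  have [m zm] := Nnil Nz; apply: xK => k Kk.
  have [k' Kk' Wk'] := zmx m k Kk.
  rewrite -(subrK (z ^+ m * x * k') (x * k)); apply: right_idealD => //.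
  by apply: Jac_W; rewrite -mulrA; apply: ideal_mulMr.
pose K' := [set q | [/\ K q, W (x * q) & forall y, N y -> W (x * y * q)]].
have K'E : K' = K.
  apply: Kmin; last by move=> q [].
  split; first split.
  - by split; rewrite ?mulr0 // => y _; rewrite mulr0.
  - move=> p q [Kp Wp Wp'] [Kq Wq Wq']; split; first exact: KB.
      by rewrite mulrBr; apply: WB.
    by move=> y Ny; rewrite mulrBr; apply: WB; [apply: Wp'|apply: Wq'].
  - move=> q a [Kq Wq Wq']; split; first exact: KM.
      by rewrite mulrA; apply: WM.
    by move=> y Ny; rewrite mulrA; apply: WM; apply: Wq'.
  - move=> q Wq; have Wyq y : N y -> W (y * q) by move=> Ny; apply: W_st.
    split; [exact: WK|exact: Wyq|].
    by move=> y Ny; rewrite -mulrA; apply: W_st => //; apply: Wyq.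
  - move=> y q Ny [Kq Wq Wq']; split; [exact: Kst|by rewrite mulrA; apply: Wq'|].
    by move=> y' Ny'; rewrite mulrA -(mulrA x); apply: Wq'; apply: NM.
  - move=> K'W; apply: xK => k Kk; apply: K'W; split; first exact: Kst.
      rewrite mulrA; apply: xyx => //; exists 1; first by rewrite mulr1.
      by move=> q; rewrite mul1r.
    move=> y Ny; rewrite mulrA; apply: xyx => //; first exact: NM.
    by exists y => // q Kq; apply: Kst.
by apply: xK => k; rewrite -K'E => -[].
Qed.

End Levitzki.

(** * Right perfect rings are pi-regular *)

Lemma idemX (R : pzRingType) (x : R) n : x * x = x -> x ^+ n.+1 = x.
Proof. by move=> xx; elim: n => [|n IHn]; rewrite ?expr1 // exprS IHn. Qed.

Section RightPerfect.
Variable R : pzRingType.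
Implicit Types (x y z a b c e u v w t j : R).

Lemma right_artinian_pi_regular : right_artinian R -> pi_regular R.
Proof.
move=> art a.
apply: (art (fun n => principal_right_ideal (a ^+ n.+1))) => n.
  exact: principal_right_ideal_id.
by move=> _ [r _ <-]; exists (a * r); rewrite ?mulrA // -exprSr.
Qed.

(* If [(x (1 - x)) ^+ n = 0], the witness is [1 - (1 - x ^+ n) ^+ n], a multiple
   of [x ^+ n] whose complement is a multiple of [(1 - x) ^+ n]. *)
Lemma nil_idem_lift : (forall x, x \in Jac R -> exists n, x ^+ n = 0) ->
  forall x, x * x - x \in Jac R -> exists e, e * e = e /\ e - x \in Jac R.
Proof.
move=> nil x xJ; have [n0 n0P] := nil _ xJ.
pose n := n0.+1; pose z := x ^+ n; pose e := 1 - (1 - z) ^+ n.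
have c1 y : GRing.comm y (1 - y) by rewrite /GRing.comm mulrBl mulrBr mul1r mulr1.
have xn : z * (1 - x) ^+ n = 0.
  rewrite -exprMn_comm // mulrBr mulr1 -opprB exprNn.
  by rewrite exprS (exprS (_ - _)) n0P !mulr0.
exists e; split.
  have [s eE] : exists s, e = s * z.
    have /eqP := subrX1 (1 - z) n; rewrite addrAC subrr add0r => /eqP h.
    exists (\sum_(i < n) (1 - z) ^+ i); rewrite /e -opprB h mulNr opprK.
    by apply: commr_sum => i _; apply: commrX.
  have [t fE] : exists t, 1 - e = (1 - x) ^+ n * t.
    exists ((\sum_(i < n) x ^+ i) ^+ n); rewrite /e subKr -exprMn_comm.
      by rewrite -[1 - z]opprB subrX1 -mulNr opprB.
    by apply: commr_sum => i _; apply: commrX; apply/commr_sym/c1.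
  have: e * (1 - e) = 0 by rewrite {1}eE fE -mulrA (mulrA z) xn mul0r mulr0.
  by rewrite mulrBr mulr1 => /eqP; rewrite subr_eq0 => /eqP.
rewrite -(quot_piP (Jac R : ideal R)) /e /z; apply/eqP.
have pp : quot_pi (Jac R : ideal R) x * quot_pi _ x = quot_pi _ x.
  by rewrite -rmorphM; apply/eqP; rewrite quot_piP.
rewrite !(rmorphB, rmorph1, rmorphXn) /= /n !idemX ?idemC //.
by rewrite subKr.
Qed.

(** An element [x] of the corner congruent to [e] is the restriction of the unit [1 - (e - x)].
    Applied to [u * c] and [c * u], cut down to the corner, this yields a right and a left inverse
    of [u], which coincide. *)
Lemma corner_unit_mod_Jac e u c : e * e = e -> e * u = u -> u * e = u ->
  u * c - e \in Jac R -> c * u - e \in Jac R ->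
  exists w, [/\ e * w = w, w * e = w, u * w = e & w * u = e].
Proof.
move=> ee eu ue Juc Jcu.
have half x y : e * x = x -> x * e = x -> x - e \in Jac R ->
    (exists2 t, x * t = e & True) /\ (exists2 t, t * x = e & True).
  move=> ex xe Jx; have [t [t1 t2]] : exists t, (1 - (e - x)) * t = 1 /\
      t * (1 - (e - x)) = 1.
    by apply: Jac_unit; rewrite -rpredN opprB.
  split; [exists (t * e)|exists (e * t)] => //.
    rewrite mulrA; have -> : x = e * (1 - (e - x)).
      by rewrite mulrBr mulr1 mulrBr ee ex subKr.
    by rewrite -(mulrA e) t1 mulr1 ee.
  rewrite -mulrA; have -> : x = (1 - (e - x)) * e.
    by rewrite mulrBl mul1r mulrBl ee xe subKr.
  by rewrite (mulrA t) t2 mul1r ee.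
have [[t1 ut1 _] _] : (exists2 t, (u * (c * e)) * t = e & True) /\
    (exists2 t, t * (u * (c * e)) = e & True).
  apply: half; rewrite ?mulrA ?eu // -?mulrA ?ee //.
  by rewrite -[X in _ - X]ee mulrA -mulrBl; apply: ideal_mulMr.
have [_ [t2 ut2 _]] : (exists2 t, (e * c * u) * t = e & True) /\
    (exists2 t, t * (e * c * u) = e & True).
  apply: half; rewrite -?mulrA ?ue // ?mulrA ?ee //.
  by rewrite -mulrA -[X in _ - X]ee -mulrBr; apply: ideal_mulMl.
pose w1 := e * (c * e * t1) * e; pose w2 := e * (t2 * e * c) * e.
have uw1 : u * w1 = e.
  by rewrite /w1 2!(mulrA u) ue (mulrA u) ut1 ee.
have w2u : w2 * u = e.
  by rewrite /w2 -mulrA eu -(mulrA e) -(mulrA t2) -(mulrA t2) ut2 ee.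
have w12 : w1 = w2.
  have -> : w1 = w2 * u * w1 by rewrite w2u /w1 !mulrA ee.
  by rewrite -mulrA uw1 /w2 -!mulrA ee.
exists w1; split; [..|by rewrite w12] => //.
  by rewrite /w1 !mulrA ee.
by rewrite /w1 -mulrA ee.
Qed.
End RightPerfect.

Section RightPerfectPiRegular.
Variable R : pzRingType.
Hypothesis Rrp : right_perfect R.
Implicit Types (x y z a b c e u v w t j : R).

Lemma right_perfect_Jac_nil x : x \in Jac R -> exists n, x ^+ n = 0.
Proof.
move=> xJ; have [_ /(_ (fun=> x))[//|N /(_ N (leqnn N)) xN]] := Rrp.
exists N.+1; rewrite -{}xN.
by elim: N => [|N IHN] /=; rewrite ?expr1 // exprS IHN.
Qed.

(** The quotient by the radical is artinian, hence pi-regular, and its idempotents lift because the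
    radical is nil. Passing to the power [A] removes the nilpotent part. *)
Lemma right_perfect_fitting_mod_Jac a : exists k e c, let A := a ^+ k.+1 in
  [/\ e * e = e, (1 - e) * A \in Jac R, A * e - e * A \in Jac R,
      A * c - e \in Jac R & c * A - e \in Jac R].
Proof.
have [[/right_artinian_pi_regular Qpi _] _] := Rrp.
set J : ideal R := Jac R.
have [e' [b' [k [F nil]]]] := pi_regular_fitting (quot_pi J a) Qpi.
have [e'e' ae' [eb' be'] _ _] := F.
have [e [ee eE]] : exists e, e * e = e /\ quot_pi J e = e'.
  have [|e [ee eJ]] := nil_idem_lift right_perfect_Jac_nil (x := repr e').
    by rewrite -(quot_piP J) rmorphM /= quot_piW e'e'.
  by exists e; split=> //; rewrite -[RHS]quot_piW; apply/eqP; rewrite quot_piP.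
exists k, e, (repr (b' ^+ k.+1)).
have ae'k : e' * quot_pi J a ^+ k.+1 = quot_pi J a ^+ k.+1 * e'.
  by apply: commrX.
split=> //.
- rewrite -[_ * _]subr0 -(quot_piP J) rmorphM rmorphB rmorph1 rmorphXn rmorph0 /= eE.
  rewrite -(idemX k (idemC e'e')) -exprMn_comm; last exact: comm_idemC.
  by rewrite exprSr nil mul0r.
- by rewrite -(quot_piP J) !rmorphM rmorphXn /= eE ae'k.
- by rewrite -(quot_piP J) rmorphM /= quot_piW rmorphXn /= eE (fitting_exp k F).
- rewrite -(quot_piP J) rmorphM /= quot_piW rmorphXn /= eE.
  rewrite -(fitting_exp k F); apply/eqP; apply: commrX; apply: commr_sym.
  by apply: commrX; apply: fitting_comm F.
Qed.

(* Column reduction: [(e + v)R + tR] is sent by [A] to [(e + v')R + jtR]. *)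
Lemma fitting_column_step A e c v : e * e = e ->
  (1 - e) * A \in Jac R -> A * e - e * A \in Jac R ->
  A * c - e \in Jac R -> c * A - e \in Jac R ->
  [/\ v \in Jac R, e * v = 0 & v * e = v] ->
  exists v', [/\ v' \in Jac R, e * v' = 0 & v' * e = v'] /\
    exists j u w, [/\ j \in Jac R, e + v' = A * (e + v) * w,
      A * (e + v) = (e + v') * u & A = (e + v') * A + j].
Proof.
move=> ee fA Ae Ac cA [vJ ev ve].
pose g := e + v.
have ge : g * e = g by rewrite /g mulrDl ee ve.
have eg : e * g = e by rewrite /g mulrDr ee ev addr0.
pose J : ideal R := Jac R.
have pg : quot_pi J g = quot_pi J e.
  by apply/eqP; rewrite quot_piP /g addrAC subrr add0r.
have pfA : quot_pi J e * quot_pi J A = quot_pi J A.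
  rewrite -rmorphM; apply/eqP; rewrite quot_piP -rpredN opprB.
  by rewrite -[X in X - _]mul1r -mulrBl.
have pAe : quot_pi J A * quot_pi J e = quot_pi J A.
  by rewrite -[RHS]pfA -!rmorphM; apply/eqP; rewrite quot_piP.
have pAc : quot_pi J A * quot_pi J c = quot_pi J e.
  by rewrite -rmorphM; apply/eqP; rewrite quot_piP.
have pcA : quot_pi J c * quot_pi J A = quot_pi J e.
  by rewrite -rmorphM; apply/eqP; rewrite quot_piP.
(* Modulo the radical [e * A * g] is [A], with inverse [c]. Its corner inverse [w] renormalizes
   [A * g] to a column whose component under [e] is again [e]. *)
have [||||w [ew we uw wu]] := @corner_unit_mod_Jac R e (e * A * g) c ee.
- by rewrite !mulrA ee.
- by rewrite -mulrA ge.
- by rewrite -(quot_piP J) !rmorphM /= pg pfA pAe pAc.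
- by rewrite -(quot_piP J) !rmorphM /= pg pfA pAe pcA.
have ff : e * (1 - e) = 0 by rewrite mulrBr mulr1 ee subrr.
pose v' := (1 - e) * A * g * w.
have v'J : v' \in Jac R by rewrite /v' -!mulrA mulrA; apply: ideal_mulMr.
have ev' : e * v' = 0 by rewrite /v' !mulrA ff !mul0r.
have v'e : v' * e = v' by rewrite /v' -mulrA we.
have gE : e + v' = A * g * w.
  rewrite /v' -!(mulrA (1 - e)) mulrBl mul1r (mulrA e) (mulrA e) uw.
  by rewrite addrC subrK.
exists v'; split=> //; exists ((1 - e) * A - v' * A), (e * A * g), w; split=> //.
- by rewrite rpredB //; apply: ideal_mulMr.
- by rewrite gE -!mulrA (mulrA e) wu ge.
- by rewrite mulrDl mulrBl mul1r addrACA subrr addr0 addrC subrK.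
Qed.

(** Column reduction puts [A ^+ n] in [(e + g n)R + t n], where [t n] acquires a radical factor on
    the left at each step. Right perfectness kills [t n], and then the columns [e + g n]
    stabilize. *)
Lemma right_perfect_pi_regular : pi_regular R.
Proof.
apply: pi_regularP => a.
have [k [e [c [ee fA Ae Ac cA]]]] := right_perfect_fitting_mod_Jac a.
set A := a ^+ k.+1 in fA Ae Ac cA.
pose P v := [/\ v \in Jac R, e * v = 0 & v * e = v].
have [||g gP] := @dependent_choice_seq R P (fun v v' =>
    exists j u w, [/\ j \in Jac R, e + v' = A * (e + v) * w,
      A * (e + v) = (e + v') * u & A = (e + v') * A + j]).
- by exists 0; split; rewrite ?rpred0 ?mul0r ?mulr0.
- by move=> v Pv; apply: fitting_column_step cA Pv.
have [j jP] := choice (fun n => proj2 (gP n)).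
pose t n := if n is m.+1 then left_prod j m * (1 - (e + g 0%N)) else 1 - (e + g 0%N).
have tS n : t n.+1 = j n * t n by case: n => [|n] /=; rewrite -?mulrA.
have AX n : exists c, A ^+ n = (e + g n) * c + t n.
  elim: n => [|n [d AE]]; first by exists 1; rewrite expr0 mulr1 addrC subrK.
  have [u [w [_ _ AgE jE]]] := jP n.
  exists (u * d + A * t n); rewrite exprS AE mulrDr mulrA AgE tS.
  by rewrite (mulrDr (e + _)) !mulrA -addrA -mulrDl -jE.
have gX n : exists x, e + g n = A ^+ n * x.
  elim: n => [|n [x gE]]; first by exists (e + g 0%N); rewrite expr0 mul1r.
  have [u [w [_ gE' _ _]]] := jP n.
  by exists (x * w); rewrite gE' gE exprS !mulrA.
have [_ /(_ j)[n|N jN]] := Rrp; first by case: (jP n) => u [w []].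
have [d AN] := AX N.+1; rewrite /= jN // mul0r addr0 in AN.
have [x gE] := gX N.+2.
have ge n : e * (e + g n) = e /\ (e + g n) * e = e + g n.
  by have [[_ eg ge] _] := gP n; rewrite mulrDr mulrDl ee eg ge addr0.
pose y := d * A * x.
have gy : e + g N.+2 = (e + g N.+1) * y.
  by rewrite gE exprSr AN /y !mulrA.
(* Both columns have component [e] under [e], so a right multiple of the first that equals the
   second must be the first. *)
have ey : e * y = e.
  by rewrite -[RHS](ge N.+2).1 gy mulrA (ge N.+1).1.
have gN : e + g N.+1 = e + g N.+2.
  by rewrite gy -{2}(ge N.+1).2 -mulrA ey (ge N.+1).2.
exists (k.+1 * N.+1)%N, (a ^+ k * x * d).
have AE : A ^+ N.+1 = A ^+ N.+1 * (a * a ^+ k) * x * d.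
  by rewrite -exprS -/A -exprSr -gE -gN.
by rewrite exprSr exprM -/A {1}AE !mulrA.
Qed.

End RightPerfectPiRegular.

(** * Subrings of semilocal pi-regular rings *)

Section Words.
Variable R : pzRingType.
Implicit Types (N M : set R) (J : ideal R) (p r x y : R) (m n : nat).

Lemma words1 N x : N x -> words N 1 x.
Proof. by move=> Nx; exists 1 => //; exists x; rewrite ?mul1r. Qed.

Lemma words_mul N m n x y : words N m x -> words N n y -> words N (m + n) (x * y).
Proof.
move=> Nx; elim: n y => [|n IHn] y /=; first by move=> ->; rewrite addn0 mulr1.
move=> [q qN [z zN <-]]; rewrite addnS; exists (x * q); first exact: IHn.
by exists z; rewrite ?mulrA.
Qed.

Lemma words_add N m n p : words N (m + n) p ->
  exists x y, [/\ words N m x, words N n y & p = x * y].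
Proof.
elim: n p => [|n IHn] p; first by rewrite addn0 => Np; exists p, 1; rewrite mulr1.
rewrite addnS => -[_ /IHn[x [y [xN yN ->]]] [z zN <-]].
by exists x, (y * z); split; rewrite ?mulrA //; exists y => //; exists z.
Qed.

Lemma words_words N m n : words N (m * n) `<=` words (words N n) m.
Proof.
elim: m => [|m IHm] // p; rewrite mulSn => /words_add[x [y [xN /IHm yN ->]]].
by rewrite -[m.+1]add1n; apply: words_mul yN; apply: words1.
Qed.

Lemma words_sub N M n : N `<=` M -> words N n `<=` words M n.
Proof.
move=> NM; elim: n => [|n IHn] // _ [p /IHn pM [y /NM yM <-]].
by exists p => //; exists y.
Qed.

Lemma words_map (S : pzRingType) (f : {rmorphism R -> S}) N n p :
  words N n p -> words (f @` N) n (f p).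
Proof.
elim: n p => [|n IHn] p /=; first by move=> ->; rewrite rmorph1.
move=> [q /IHn qN [y Ny <-]]; exists (f q) => //.
by exists (f y); [exists y|rewrite rmorphM].
Qed.

(** Induction replaces [K] by the [z] with [K (a i * z)]. The factor [r] is there because the zeroth
    power is the whole ring. *)
Lemma ideal_pow_words J (K : set R) n x : K 0 ->
  (forall x y, K x -> K y -> K (x + y)) ->
  (forall p r, words [set` J] n p -> K (p * r)) -> ideal_pow J n x -> K x.
Proof.
elim: n K x => [|n IHn] K x K0 KD KJ /=.
  by move=> _; rewrite -[x]mul1r; apply: KJ.
move=> [k [a [b [aJ bJ ->]]]].
have Kab i : K (a i * b i).
  apply: (IHn (fun z => K (a i * z))) (bJ i).
  - by rewrite mulr0.
  - by move=> u v Ku Kv; rewrite mulrDr; apply: KD.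
  - move=> p r pJ; rewrite mulrA; apply: KJ; rewrite -[n.+1]add1n.
    by apply: words_mul pJ; apply: words1; apply: aJ.
by apply: big_ind => // i _; apply: Kab.
Qed.

Lemma words_ideal_pow J n p r : words [set` J] n p -> ideal_pow J n (p * r).
Proof.
elim: n p => [|n IHn] p //; rewrite -{1}[n.+1]add1n => /words_add pJ.
have [x [y [[_ -> [a aJ <-]] yJ ->]]] := pJ.
exists 1%N, (fun=> a), (fun=> y * r); split=> //; first by move=> i; apply: IHn.
by rewrite big_ord1 mul1r mulrA.
Qed.

Lemma ideal_pow0 J n : ideal_pow J n 0.
Proof.
case: n => //= n; exists 0%N, (fun=> 0), (fun=> 0).
by split; rewrite ?big_ord0 // => -[].
Qed.

Lemma left_prod_words N (u : nat -> R) n : (forall i, N (u i)) ->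
  words N n.+1 (left_prod u n).
Proof.
move=> Nu; elim: n => [|n IHn]; first by apply: words1; apply: Nu.
by rewrite -[n.+2]add1n; apply: words_mul IHn; apply: words1; apply: Nu.
Qed.

Lemma left_prod_cat (u : nat -> R) k m :
  left_prod u (k + m.+1) = left_prod (fun i => u (i + m.+1)%N) k * left_prod u m.
Proof. by elim: k => [|k IHk] //=; rewrite IHk mulrA. Qed.

Lemma left_prod_blocks (u : nat -> R) n m :
  left_prod (fun i => left_prod (fun l => u (l + i * n.+1)%N) n) m =
  left_prod u (n + m * n.+1).
Proof.
elim: m => [|m IHm].
  rewrite /= mul0n addn0; congr left_prod.
  by apply/funext => l; rewrite addn0.
have -> : (n + m.+1 * n.+1 = n + (n + m * n.+1).+1)%N by rewrite mulSn addSn.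
by rewrite left_prod_cat -IHm /=.
Qed.

Lemma left_prod_map (S : pzRingType) (f : {rmorphism R -> S}) (u : nat -> R) n :
  f (left_prod u n) = left_prod (f \o u) n.
Proof. by elim: n => [|n IHn] //=; rewrite rmorphM IHn. Qed.

End Words.

(** The idempotent of [x] is [x * b], which lies in the radical and so is [0]. *)
Lemma quasi_fitting_Jac_topnil (R : pzRingType) (F : set (ideal R)) x :
  quasi_fitting F -> x \in Jac R -> topnil F x.
Proof.
move=> /(_ x)[e [b [[ee _ _ xb _] nx]]] xJ.
suff e0 : e = 0 by rewrite e0 subr0 mul1r in nx.
by apply: Jac_idem0 => //; rewrite -xb; apply: ideal_mulMr.
Qed.

Section Subring.
Variables (A B : pzRingType) (f : {rmorphism A -> B}).
Hypotheses (finj : injective f) (Api : pi_regular A) (Bpi : pi_regular B).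

Let Bsc : strongly_clean B :=
  quasi_fitting_strongly_clean (@separated_zero B) (pi_regular_quasi_fitting Bpi).

Lemma sub_semilocal_semiperfect : semilocal B -> semiperfect A.
Proof.
move=> /semilocal_acc_idem/(acc_idem_inj finj); apply: strongly_clean_semiperfect.
exact: quasi_fitting_strongly_clean (@separated_zero A) (pi_regular_quasi_fitting Api).
Qed.

(** The radical of the pi-regular ring [A] is nil, so its image is a nil semigroup to which
    Levitzki's theorem applies. The length [n.+1] suits [left_prod], whose products are never
    empty. *)
Lemma sub_Jac_words : semilocal B ->
  exists n, words [set` Jac A] n.+1 `<=` f @^-1` [set` Jac B].
Proof.
move=> /semilocal_acc_idem Bacc.
have [||n nP] := @nil_semigroup_nilpotent B (f @` [set` Jac A]) Bsc Bacc.
- move=> _ _ [x xJ <-] [y yJ <-]; exists (x * y); last exact: rmorphM.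
  by apply: ideal_mulMl.
- move=> _ [x xJ <-].
  have [n] := quasi_fitting_Jac_topnil (pi_regular_quasi_fitting Api) xJ erefl.
  rewrite zero_idealE => /eqP xn.
  by exists n; rewrite -rmorphXn /= xn rmorph0 rpred0.
exists n => _ [p pJ [y yJ <-]] /=.
by rewrite rmorphM; apply: ideal_mulMr; apply: nP; apply: words_map.
Qed.

Lemma sub_semiprimary : semiprimary B -> semiprimary A.
Proof.
move=> [Bsl [m mP]]; split; first by have [] := sub_semilocal_semiperfect Bsl.
have [n nP] := sub_Jac_words Bsl; exists (m * n.+1)%N.
apply/seteqP; split=> [x|_ ->]; last exact: ideal_pow0.
apply: (ideal_pow_words (K := [set 0])) => [//|x1 y -> ->|p r /words_words pJ].
  by rewrite addr0.
apply: finj; rewrite rmorph0 rmorphM.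
suff : ideal_pow (Jac B : ideal B) m (f p * f r) by rewrite mP.
apply: words_ideal_pow; apply: words_sub (words_map f pJ).
by move=> _ [y yJ <-]; apply: nP.
Qed.

(** Blocks of length [n.+1] land in the radical of [B], so the product of blocks vanishes there, and
    in [A] by injectivity. *)
Lemma sub_right_perfect : right_perfect B -> right_perfect A.
Proof.
move=> [Bsl Brp]; split; first by have [] := sub_semilocal_semiperfect Bsl.
move=> u uJ; have [n nP] := sub_Jac_words Bsl.
have [|N NP] := Brp (fun i => f (left_prod (fun l => u (l + i * n.+1)%N) n)).
  by move=> i; apply: nP; apply: left_prod_words => l; apply: uJ.
have u0 : left_prod u (n + N * n.+1) = 0.
  by apply: finj; rewrite -left_prod_blocks left_prod_map rmorph0; apply: NP.
exists (n + N * n.+1)%N => k /subnKC <-.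
elim: (k - _)%N => [|l IHl]; first by rewrite addn0.
by rewrite addnS /= IHl mulr0.
Qed.

End Subring.

Lemma semiprimary_right_perfect (R : pzRingType) : semiprimary R -> right_perfect R.
Proof.
move=> [Rsl [n nP]]; split=> // u uJ; exists n => k nk.
have : words [set` Jac R] k.+1 (left_prod u k) by apply: left_prod_words.
rewrite -(subnKC (leqW nk)) => /words_add[x [y [/(words_ideal_pow y) + _ ->]]].
by rewrite nP.
Qed.

Lemma semiprimary_pi_regular (R : pzRingType) : semiprimary R -> pi_regular R.
Proof. by move=> /semiprimary_right_perfect/right_perfect_pi_regular. Qed.

(** * Topology of the inverse limit and semi-invariance *)

Lemma invlim_proj_continuous d (I : preorderType d) (X : inverse_system I) i :
  continuous (@invlim_proj d I X i : _ -> discrete_topology (X i)).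
Proof.
move=> x; apply: (@continuous_comp _ _ _ (val : invlim X -> sys_prod X)
   (fun x : sys_prod X => x i)); first exact: val_continuous.
exact: (@proj_continuous I (fun i => discrete_topology (X i)) i).
Qed.

Lemma open_ideals_separated (S : topRingType) :
  hausdorff_space S -> linearly_topologized S ->
  separated [set J : ideal S | nbhs (0 : S) [set` J]].
Proof.
move=> hS ltS x h; apply/esym; apply: hS => A B A0 Bx.
have [J [J0 JA]] := ltS _ A0; exists x; split; last exact: nbhs_singleton.
by apply: JA; apply: h.
Qed.

Lemma embedding_continuous (U V : topologicalType) (f : U -> V) :
  topological_embedding f -> continuous f.
Proof. by move=> [_ fE]; apply/continuousP => A oA; apply/fE; exists A. Qed.

Section LimitTopology.
Variables (d : Order.disp_t) (I : preorderType d) (X : inverse_system I).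
Variables (R : topRingType) (phi : {rmorphism R -> invlim X}).
Hypothesis hphi : top_ring_iso phi.

Lemma std_map_compat i j (ij : (i <= j)%O) r :
  sys_map X ij (std_map phi j r) = std_map phi i r.
Proof. exact: invlim_compat. Qed.

Lemma J_decr i j : (i <= j)%O -> {subset J_ phi j <= J_ phi i}.
Proof.
move=> ij x; rewrite !inE => /eqP xj; apply/eqP.
by rewrite -(std_map_compat ij) xj rmorph0.
Qed.

Lemma std_map_lift (x : forall i, X i) :
  (forall i j (ij : (i <= j)%O), sys_map X ij (x j) = x i) ->
  exists r, forall i, std_map phi i r = x i.
Proof.
move=> xc; have [_ [g [_ gK _]]] := hphi.
have xcP : (x : sys_prod X) \in compatible X by apply/asboolP.
exists (g (exist _ (x : sys_prod X) xcP)) => i.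
by rewrite /= gK.
Qed.

Lemma std_map_inj r s : (forall i, std_map phi i r = std_map phi i s) -> r = s.
Proof.
move=> rs; have [_ [g [gK _ _]]] := hphi.
apply: (can_inj gK); apply: val_inj; apply: functional_extensionality_dep => i.
exact: rs.
Qed.

Lemma std_map_continuous i :
  continuous (std_map phi i : R -> discrete_topology (X i)).
Proof.
move=> r; have [phic _] := hphi.
apply: (@continuous_comp _ _ _ phi
  (@invlim_proj _ _ X i : _ -> discrete_topology (X i))); first exact: phic.
exact: invlim_proj_continuous.
Qed.

Lemma J_nbhs i : nbhs (0 : R) [set` J_ phi i].
Proof.
have : nbhs (0 : R) ((std_map phi i : R -> discrete_topology (X i)) @^-1` [set 0]).
  apply: std_map_continuous; rewrite rmorph0; exact: discrete_set1.
by apply: filterS => x /= /eqP.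
Qed.

Lemma nbhs_J (U : set R) : nbhs (0 : R) U -> exists i, [set` J_ phi i] `<=` U.
Proof.
move=> U0; have [_ [g [gK phiK gc]]] := hphi.
have [[i0] dirI] := sys_directed X.
(* By directedness the kernels generate a filter on the limit. It converges to [0] coordinatewise,
   and the continuous inverse [g] carries this back to [R]. *)
pose F := filter_from [set: I] (fun i => [set y : invlim X | invlim_proj i y = 0]).
have FF : Filter F.
  apply: filter_from_filter; first by exists i0.
  move=> i j _ _; have [k [ik jk]] := dirI i j; exists k => // y /= yk.
  by split; rewrite /= -(invlim_compat ik, invlim_compat jk) yk rmorph0.
have F0 : F --> (0 : invlim X).
  move=> V [_ [[B oB <-] B0] BV]; apply: filterS BV _.
  suff : (val : invlim X -> sys_prod X) @ F --> (0 : sys_prod X).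
    by apply; apply: open_nbhs_nbhs.
  apply/cvg_sup => i W [_ [[C oC <-] C0] CW]; apply: filterS CW _.
  exists i => // y /= yi.
  suff -> : (val y : sys_prod X) i = 0 by [].
  exact: yi.
have g0 : g 0 = 0 by rewrite -(rmorph0 phi) gK.
have [i _ iU] : F (g @^-1` U) by apply: F0; apply: gc; rewrite g0.
exists i => r /= /eqP ri.
by rewrite -(gK r); apply: iU.
Qed.

Lemma separated_J : separated (range (J_ phi)).
Proof.
move=> x h; apply: std_map_inj => i; rewrite rmorph0; apply/eqP.
by apply: (h (J_ phi i)); exists i.
Qed.

Lemma invlim_quasi_fitting : (forall i, pi_regular (X i)) ->
  quasi_fitting (range (J_ phi)).
Proof.
move=> Xpi a.
have eb i : {eb : X i * X i | fitting (std_map phi i a) eb.1 eb.2 /\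
    topnil [set zero_ideal (X i)] ((1 - eb.1) * std_map phi i a)}.
  apply: cid.
  have [e [b h]] := pi_regular_quasi_fitting (Xpi i) (std_map phi i a).
  by exists (e, b).
pose e i := (sval (eb i)).1; pose b i := (sval (eb i)).2.
have fit i : fitting (std_map phi i a) (e i) (b i) by case: (svalP (eb i)).
have nil i : exists n, ((1 - e i) * std_map phi i a) ^+ n = 0.
  case: (svalP (eb i)) => _ /(_ _ erefl)[n]; rewrite zero_idealE => /eqP h.
  by exists n.
(* The image of the decomposition at [j] is one at [i], so uniqueness makes the chosen family
   compatible. *)
have ebc i j (ij : (i <= j)%O) :
    sys_map X ij (e j) = e i /\ sys_map X ij (b j) = b i.
  have fit' := fitting_map (sys_map X ij) (fit j).
  rewrite std_map_compat in fit'.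
  have := fitting_uniq (@separated_zero (X i)) fit' _ (fit i); apply.
    move=> _ ->; have [n nE] := nil j; exists n.
    rewrite zero_idealE -(std_map_compat ij) -(rmorph1 (sys_map X ij)).
    by rewrite -rmorphB -rmorphM -rmorphXn /= nE rmorph0.
  by case: (svalP (eb i)).
have [e' e'E] := std_map_lift (fun i j ij => (ebc i j ij).1).
have [b' b'E] := std_map_lift (fun i j ij => (ebc i j ij).2).
exists e', b'; split.
  split; [| |split| |]; apply: std_map_inj => i; rewrite !rmorphM ?e'E ?b'E;
    by case: (fit i) => ? ? [].
move=> _ [i _ <-]; have [n nE] := nil i; exists n; rewrite inE.
by rewrite rmorphXn rmorphM rmorphB rmorph1 e'E nE.
Qed.

Lemma topnil_continuous (S : topRingType) (h : {rmorphism R -> S}) x :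
  continuous h -> topnil (range (J_ phi)) x ->
  topnil [set J : ideal S | nbhs (0 : S) [set` J]] (h x).
Proof.
move=> hc nx J J0; have [|i iJ] := @nbhs_J (h @^-1` [set` J]).
  by apply: hc; rewrite rmorph0.
have [|n xn] := nx (J_ phi i); first by exists i.
by exists n; rewrite -rmorphXn; apply: (iJ _ xn).
Qed.

Section SemiInvariant.
Variable R0 : subringClosed R.
Hypothesis hR0 : T_semi_invariant R0.
Local Notation T := (subring_type R0).

(* The decomposition is unique in [S], hence fixed by [Sigma]. *)
Lemma semi_invariant_fitting a e b : a \in R0 -> fitting a e b ->
  topnil (range (J_ phi)) ((1 - e) * a) -> e \in R0 /\ b \in R0.
Proof.
have [S [iota [Sigma [[hS ltS] emb Sc R0P]]]] := hR0.
have ic := embedding_continuous emb.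
move=> /R0P aS fit nil.
suff h sigma : Sigma sigma -> sigma (iota e) = iota e /\ sigma (iota b) = iota b.
  by split; apply/R0P => sigma /h[].
move=> Ss; have fitS := fitting_map iota fit.
have fits := fitting_map sigma fitS; rewrite aS // in fits.
have := fitting_uniq (open_ideals_separated hS ltS) fits _ fitS; apply.
  have -> : (1 - sigma (iota e)) * iota a = (sigma \o iota) ((1 - e) * a).
    by rewrite /= !rmorphM !rmorphB !rmorph1 aS.
  apply: topnil_continuous => // x.
  by apply: continuous_comp; [apply: ic|apply: Sc].
rewrite -(rmorph1 iota) -rmorphB -rmorphM.
exact: topnil_continuous.
Qed.

(** This says that [R0] is closed: [sigma] and [iota] agree on it, so their difference at [r] equals
    that at [r - x], which lies in any prescribed open ideal. *)
Lemma semi_invariant_closed r :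
  (forall i, exists2 x, x \in R0 & r - x \in J_ phi i) -> r \in R0.
Proof.
have [S [iota [Sigma [[hS ltS] emb Sc R0P]]]] := hR0.
have ic := embedding_continuous emb.
move=> rJ; apply/R0P => sigma Ss; apply/eqP; rewrite -subr_eq0; apply/eqP.
apply: (open_ideals_separated hS ltS) => J J0.
have sc : continuous (sigma \o iota).
  by move=> x; apply: continuous_comp; [apply: ic|apply: Sc].
have [|i iJ] := @nbhs_J (iota @^-1` [set` J] `&` (sigma \o iota) @^-1` [set` J]).
  by apply: filterI; [apply: ic|apply: sc]; rewrite rmorph0.
have [x /R0P xS xi] := rJ i; have [iJ1 iJ2] := iJ _ xi.
have -> : sigma (iota r) - iota r = sigma (iota (r - x)) - iota (r - x).
  by rewrite !rmorphB /= xS // opprB addrA subrK.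
exact: rpredB.
Qed.

Lemma J0_nbhs i : nbhs (0 : T) [set` J0_ phi R0 i].
Proof.
have := @val_continuous R R0 0; rewrite /continuous_at rmorph0.
by move=> /(_ _ (J_nbhs i)).
Qed.

Lemma nbhs_J0 (U : set T) : nbhs (0 : T) U -> exists i, [set` J0_ phi R0 i] `<=` U.
Proof.
move=> [_ [[B oB <-] B0] BU]; have [|i iB] := @nbhs_J B.
  by apply: open_nbhs_nbhs.
by exists i => x xi; apply: BU; apply: (iB _ xi).
Qed.

Lemma separated_J0 : separated (range (J0_ phi R0)).
Proof.
move=> x h; apply: val_inj; rewrite rmorph0; apply: separated_J => _ [i _ <-].
by apply: (h (J0_ phi R0 i)); exists i.
Qed.

Hypothesis Xpi : forall i, pi_regular (X i).

Lemma semi_invariant_quasi_fitting : quasi_fitting (range (J0_ phi R0)).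
Proof.
move=> a; have [e [b [fit nil]]] := invlim_quasi_fitting Xpi (val a).
have [eR0 bR0] := semi_invariant_fitting (valP a) fit nil.
exists (exist _ e eR0), (exist _ b bR0); split.
  by case: fit => ? ? [? ?] ? ?; split; [| |split| |]; apply: val_inj.
move=> _ [i _ <-]; have [|n xn] := nil (J_ phi i); first by exists i.
by exists n; rewrite inE rmorphXn rmorphM rmorphB rmorph1.
Qed.

Lemma semi_invariant_quasi_pi_regular : quasi_pi_regular T.
Proof.
move=> a; have [e [b [[ee ae [eb be] ab ba] nil]]] := semi_invariant_quasi_fitting a.
exists e => f; have ea : e * a * e = e * a by rewrite -mulrA ae mulrA ee.
have fa : f * a * f = f * a.
  by rewrite /f -mulrA -(comm_idemC ae) mulrA idemC.
split=> //.
- by rewrite ea fa /f mulrBl mul1r addrC subrK.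
- exists b; rewrite ea; split; first by rewrite eb be.
    by rewrite -mulrA ab ee.
  by rewrite mulrA be ba.
move=> U /nbhs_J0[i iU]; rewrite fa.
have [|n xn] := nil (J0_ phi R0 i); first by exists i.
exists n => // m /= nm; apply: iU; exact: idealX_le nm xn.
Qed.

Lemma J0_quot_pi_regular i : pi_regular (ring_quot (J0_ phi R0 i)).
Proof.
apply: pi_regularP => a'; rewrite -[a']quot_piW; set a := repr a'.
have [e [b [[ee ae [eb be] ab ba] nil]]] := semi_invariant_quasi_fitting a.
have [|n xn] := nil (J0_ phi R0 i); first by exists i.
(* The defect [a ^+ n.+1 - a ^+ n.+2 * b] is [((1 - e) * a) ^+ n.+1]. *)
exists n.+1, (quot_pi _ b); rewrite -!rmorphXn -rmorphM /=; apply/eqP.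
rewrite quot_piP (exprSr a n.+1) -(mulrA _ a) ab.
have -> : a ^+ n.+1 * e = e * a ^+ n.+1 by apply/commr_sym/commrX/esym.
rewrite -{1}[a ^+ n.+1]mul1r -mulrBl -(idemX n (idemC ee)) -exprMn_comm.
  exact: idealX_le xn.
exact: comm_idemC.
Qed.

Lemma nbhs_J0_coset (t : T) i : nbhs t [set x : T | x - t \in J0_ phi R0 i].
Proof.
have : continuous (fun x : T => x - t).
  move=> x.
  apply: (@continuous_comp _ _ _ (fun x : T => (x, t)) (fun z : T * T => z.1 - z.2)).
    by apply: (@cvg_pair _ _ _ _ (nbhs x) (nbhs t));
      [exact: nbhs_filter|exact: cvg_id|exact: (@cvg_cst _ t _ _ (nbhs_filter x))].
  exact: sub_continuous.
by move=> /(_ t [set` J0_ phi R0 i]); apply; rewrite subrr; apply: J0_nbhs.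
Qed.

Lemma J0_can_continuous : continuous (J0_can phi R0).
Proof.
apply: continuous_into_subring; apply: prod_continuous => i t W /= Wt.
apply: filterS (nbhs_J0_coset t i) => x /=; rewrite -quot_piP => /eqP xt.
rewrite /= /quot_tuple xt; exact: nbhs_singleton Wt.
Qed.

(** Representatives in [R0] of the coordinates of [y] have compatible images in the [X i], so they
    come from one [r] in [R]; closedness of [R0] then applies to [r]. *)
Lemma J0_can_bij (y : invlim (J0_system phi R0)) : exists t, J0_can phi R0 t = y.
Proof.
pose a i : T := repr (invlim_proj i y : ring_quot (J0_ phi R0 i)).
have aE i : quot_pi (J0_ phi R0 i) (a i) = invlim_proj i y by apply: quot_piW.
have [|r rE] := std_map_lift (x := fun i => std_map phi i (val (a i))).
  move=> i j ij; rewrite std_map_compat; apply/eqP; rewrite -subr_eq0 -rmorphB.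
  suff : a j - a i \in J0_ phi R0 i by rewrite -rmorphB.
  rewrite -quot_piP aE -(invlim_compat ij) -aE; apply/eqP/esym.
  exact: quot_mapE (J0_decr ij) _.
have rJ i : r - val (a i) \in J_ phi i by rewrite inE rmorphB rE subrr.
have rR0 : r \in R0.
  by apply: semi_invariant_closed => i; exists (val (a i)) => //; apply: valP.
exists (exist _ r rR0); apply: val_inj; apply: functional_extensionality_dep => i.
transitivity (quot_pi (J0_ phi R0 i) (a i)); last exact: aE.
by apply/eqP; rewrite /= /quot_tuple quot_piP; apply: rJ.
Qed.

Lemma J0_can_iso : top_ring_iso (J0_can phi R0).
Proof.
split; first exact: J0_can_continuous.
have [g gK] := choice J0_can_bij.
have can_inj : injective (J0_can phi R0).
  move=> s t st; apply/eqP; rewrite -subr_eq0; apply/eqP.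
  apply: separated_J0 => _ [i _ <-]; rewrite -quot_piP; apply/eqP.
  exact: (congr1 (invlim_proj i) st).
exists g; split=> // [t|y U Uy]; first exact/can_inj/gK.
have [|i iU] := @nbhs_J0 [set x : T | U (g y + x)].
  have : continuous (fun x : T => g y + x).
    move=> t; have -> : (fun x : T => g y + x) =
        (fun z : T * T => z.1 - z.2) \o (fun x => (g y, - x)).
      by apply/funext => x /=; rewrite opprK.
    apply: continuous_comp; last exact: sub_continuous.
    apply: (@cvg_pair _ _ _ _ (nbhs (g y)) (nbhs (- t)));
      [exact: nbhs_filter|exact: (@cvg_cst _ (g y) _ _ (nbhs_filter t))|].
    exact: opp_continuous.
  by move=> /(_ 0 U); apply; rewrite addr0.
(* Where the coordinate [i] agrees with that of [y], the values of [g] differ from [g y] by elements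
   of [J0_ phi R0 i]. *)
have : nbhs y [set z | invlim_proj i z = invlim_proj i y].
  have := @invlim_proj_continuous _ _ (J0_system phi R0) i y.
  by move=> /(_ [set invlim_proj i y]); apply; apply: discrete_set1.
apply: filterS => z /= zy; rewrite -[g z](subrK (g y)) addrC; apply: iU.
rewrite /= -quot_piP; apply/eqP.
transitivity (invlim_proj i z : ring_quot (J0_ phi R0 i)).
  by rewrite -{2}(gK z).
by rewrite zy -{1}(gK y).
Qed.

End SemiInvariant.
End LimitTopology.

(** * Quotients and radical of a semi-invariant subring *)

Lemma quot_embedding (T B : pzRingType) (K : ideal T) (f : {rmorphism T -> B}) :
  (forall x, (x \in K) = (f x == 0)) ->
  exists h : {rmorphism ring_quot K -> B}, injective h.
Proof.
move=> KE; pose h (x : ring_quot K) : B := f (repr x).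
have hE x : h (quot_pi K x) = f x.
  by apply/eqP; rewrite /h -subr_eq0 -rmorphB -KE -quot_piP quot_piW.
have hB : zmod_morphism h.
  by move=> x y; rewrite -[x]quot_piW -[y]quot_piW -rmorphB !hE rmorphB.
have hM : monoid_morphism h.
  split=> [|x y]; first by rewrite -(rmorph1 (quot_pi K)) hE rmorph1.
  by rewrite -[x]quot_piW -[y]quot_piW -rmorphM !hE rmorphM.
pose hh : {rmorphism ring_quot K -> B} := HB.pack h
  (GRing.isZmodMorphism.Build _ _ h hB) (GRing.isMonoidMorphism.Build _ _ h hM).
exists hh => x y; rewrite -[x]quot_piW -[y]quot_piW /= !hE => fxy.
by apply/eqP; rewrite quot_piP KE rmorphB fxy subrr.
Qed.

Section SemiInvariantPiRegular.
Variables (d : Order.disp_t) (I : preorderType d) (X : inverse_system I).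
Hypothesis Xpi : forall i : I, pi_regular (X i).
Variables (R : topRingType) (phi : {rmorphism R -> invlim X}).
Hypothesis hphi : top_ring_iso phi.
Variable R0 : subringClosed R.
Hypothesis hR0 : T_semi_invariant R0.
Local Notation T := (subring_type R0).

Lemma J0_quot_properties i :
  [/\ pi_regular (ring_quot (J0_ phi R0 i)),
      semiprimary (X i) -> semiprimary (ring_quot (J0_ phi R0 i)),
      right_perfect (X i) -> right_perfect (ring_quot (J0_ phi R0 i))
    & semiperfect (X i) -> semiperfect (ring_quot (J0_ phi R0 i))].
Proof.
have Qpi := J0_quot_pi_regular hphi hR0 Xpi (i := i).
have [|h hinj] := @quot_embedding T (X i) (J0_ phi R0 i)
  (std_map phi i \o (val : {rmorphism T -> R})); first by [].
split=> //; [exact: sub_semiprimary hinj _ _|exact: sub_right_perfect hinj _ _|].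
by move=> [Xsl _]; apply: sub_semilocal_semiperfect hinj _ Xsl.
Qed.

(** Choose [k] with [J_ phi k + Jac R] minimal. An element of [J_ phi k] outside the radical would
    yield a nonzero idempotent [g] in [J_ phi k]; minimality and directedness place [g] in every
    kernel, contradicting separatedness. *)
Lemma J_sub_Jac : strongly_clean R -> acc_idem R ->
  exists k, [set` J_ phi k] `<=` [set` Jac R].
Proof.
move=> Rsc Racc; have [[i0] dirI] := sys_directed X.
pose K i : set R := [set x | exists2 y, y \in J_ phi i & x - y \in Jac R].
have [||_ [k _ <-] kmin] := @right_ideal_min R Rsc Racc (range K).
- by exists (K i0), i0.
- move=> _ [i _ <-]; split; last first.
    by move=> x /= xJ; exists 0; rewrite ?rpred0 ?subr0.
  split.
  + by exists 0; rewrite ?subrr rpred0.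
  + move=> x y [x' x'J xx'] [y' y'J yy']; exists (x' - y'); first exact: rpredB.
    have -> : x - y - (x' - y') = (x - x') - (y - y').
      by rewrite !opprD !opprK addrACA.
    exact: rpredB.
  + move=> x a [x' x'J xx']; exists (x' * a); first exact: ideal_mulMr.
    by rewrite -mulrBl; apply: ideal_mulMr.
exists k => x /= xk; apply: contraPT isT => /(idem_of_notin_Jac Rsc)[w].
set g := x * w => -[/eqP g0 gg]; exfalso; apply: g0.
have gk : g \in J_ phi k by apply: ideal_mulMr.
apply: (separated_J hphi) => _ [i _ <-].
have [m [im km]] := dirI i k; apply: (J_decr im).
have [y ym gy] : K m g.
  rewrite (kmin (K m)); first by exists g; rewrite ?subrr ?rpred0.
    by exists m.
  by move=> z [z' z'm zz']; exists z' => //; apply: J_decr z'm.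
have [t [gt _]] : exists t, (1 - (g - y) * g) * t = 1 /\ t * (1 - (g - y) * g) = 1.
  by apply: Jac_unit; apply: ideal_mulMr.
(* For idempotent [g], [g * (1 - (g - y) * g) = g * y * g], and the second factor is a unit with
   inverse [t]. *)
have -> : g = g * y * g * t.
  rewrite -{1}[g]mulr1 -gt mulrA; congr (_ * t).
  by rewrite mulrBr mulr1 mulrBl mulrBr gg gg subKr mulrA.
by do 2 apply: ideal_mulMr; apply: ideal_mulMl.
Qed.

Lemma semi_invariant_semiperfect :
  ~ (exists E : set R, infinite_set E /\ orthogonal_idempotents E) ->
  semiperfect T /\
  exists n : nat, forall x : T, ideal_pow (Jac T : ideal T) n x -> val x \in Jac R.
Proof.
move=> /acc_idem_orthogonal Racc.
have Rsc := quasi_fitting_strongly_clean (separated_J hphi)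
  (invlim_quasi_fitting hphi Xpi).
have Tq := semi_invariant_quasi_fitting hphi hR0 Xpi.
have Tsc := quasi_fitting_strongly_clean (separated_J0 hphi (R0 := R0)) Tq.
have Tacc : acc_idem T := acc_idem_inj val_inj Racc.
split; first exact: strongly_clean_semiperfect.
have [k kJ] := J_sub_Jac Rsc Racc.
(* Elements of [Jac T] are topologically nilpotent, so they have a power in [J_ phi k], hence in
   [Jac R]. *)
have [||n nP] := @nil_semigroup_nilpotent R (val @` [set` Jac T]) Rsc Racc.
- move=> _ _ [x xJ <-] [y yJ <-]; exists (x * y); last exact: rmorphM.
  by apply: ideal_mulMl.
- move=> _ [x xJ <-].
  have [|n xn] := quasi_fitting_Jac_topnil Tq xJ (J := J0_ phi R0 k).
    by exists k.
  by exists n; apply: kJ; move: xn; rewrite inE rmorphXn.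
exists n => z; apply: (@ideal_pow_words _ _ [set x : T | val x \in Jac R]) => /=.
- exact: rpred0.
- by move=> x y xJ yJ; apply: rpredD xJ yJ.
- move=> p r pJ; apply: ideal_mulMr; apply: nP.
  exact: (words_map (val : {rmorphism T -> R}) pJ).
Qed.

End SemiInvariantPiRegular.

(** The presentation of [R] is the one supplied by [pro P R], so pi-regularity of its terms is drawn
    from [P]. Each quotient of the subring embeds in such a term. *)
Lemma semi_invariant_pro (P : pzRingType -> Prop) (R : topRingType)
    (R0 : subringClosed R) :
  T_semi_invariant R0 -> (forall B, P B -> pi_regular B) ->
  (forall (A B : pzRingType) (f : {rmorphism A -> B}), injective f ->
     pi_regular A -> P B -> P A) ->
  pro P R -> pro P (subring_type R0).
Proof.
move=> hR0 Ppi Psub [d [I [X [phi [hphi PX]]]]].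
have Xpi i : pi_regular (X i) by apply: Ppi.
exists d, I, (J0_system phi R0), (J0_can phi R0).
split; first exact: J0_can_iso.
move=> i; have [|h hinj] := @quot_embedding (subring_type R0) (X i) (J0_ phi R0 i)
  (std_map phi i \o (val : {rmorphism subring_type R0 -> R})); first by [].
apply: Psub hinj _ (PX i); exact: (J0_quot_pi_regular hphi hR0 Xpi).
Qed.

Theorem theorem5p15 (d : Order.disp_t) (I : preorderType d)
    (X : inverse_system I) (hX : forall i : I, pi_regular (X i))
    (R : topRingType) (phi : {rmorphism R -> invlim X})
    (hphi : top_ring_iso phi)
    (R0 : subringClosed R) (hR0 : T_semi_invariant R0) :
  [/\
      quasi_pi_regular (subring_type R0) /\ top_ring_iso (J0_can phi R0),
      (~ exists E : set R, infinite_set E /\ orthogonal_idempotents E) ->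
        semiperfect (subring_type R0) /\
        exists n : nat, forall x : subring_type R0,
          ideal_pow (Jac (subring_type R0) : ideal (subring_type R0)) n x ->
          val x \in Jac R
    &
      (forall i : I,
        [/\ pi_regular (ring_quot (J0_ phi R0 i)),
            semiprimary (X i) -> semiprimary (ring_quot (J0_ phi R0 i)),
            right_perfect (X i) -> right_perfect (ring_quot (J0_ phi R0 i))
          & semiperfect (X i) -> semiperfect (ring_quot (J0_ phi R0 i))]) /\
      [/\ pro semiprimary R -> pro semiprimary (subring_type R0),
          pro right_perfect R -> pro right_perfect (subring_type R0)
        & pro pi_regular_semiperfect R ->
          pro pi_regular_semiperfect (subring_type R0)]].
Proof.
split.
- split; first exact: (semi_invariant_quasi_pi_regular hphi hR0 hX).
  exact: J0_can_iso.
- exact: (semi_invariant_semiperfect hX hphi hR0).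
- split; first exact: J0_quot_properties.
  split; apply: semi_invariant_pro => //.
  + exact: semiprimary_pi_regular.
  + move=> A B f finj Api Bsp; apply: (sub_semiprimary finj Api _ Bsp).
    exact: semiprimary_pi_regular.
  + exact: right_perfect_pi_regular.
  + move=> A B f finj Api Brp; apply: (sub_right_perfect finj Api _ Brp).
    exact: right_perfect_pi_regular.
  + by move=> B [].
  + move=> A B f finj Api [Bpi [Bsl _]]; split=> //.
    exact: sub_semilocal_semiperfect finj Api Bsl.
Qed.
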